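(* Let $G$ be a Polish group and let $X$ be a Borel $G$-space. Then the following are equivalent: (1) $X$ is not countably $G$-paradoxical; (2) there is a $G$-invariant Borel probability measure on $X$.
   Context: A Polish space (group) is a separable, completely metrizable topological space (group). A standard Borel space is a Polish space with its associated Borel structure. For a Polish group $G$, a Borel $G$-space is a standard Borel space $X$ together with an action $G\times X\to X$, $(g,x)\mapsto g\cdot x$, of $G$ that is a Borel map. Borel sets $A,B\subseteq X$ are equivalent by countable decomposition, written $A\sim_\infty B$, if there are a countable index set $I$, partitions $A=\bigcup_{i\in I}A_i$ and $B=\bigcup_{i\in I}B_i$ into (pairwise disjoint) Borel sets, and elements $g_i\in G$ $(i\in I)$ with $g_i\cdot A_i=B_i$ for all $i\in I$. The space $X$ is countably $G$-paradoxical if there are Borel sets $A,B\subseteq X$ with $A\cap B=\emptyset$ and $X\sim_\infty A\sim_\infty B$. Probability measures are countably additive; a Borel probability measure $\mu$ on $X$ is $G$-invariant if $\mu(A)=\mu(g\cdot A)$ for all $g\in G$ and all Borel $A\subseteq X$. *)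

(* Defs.v *)
From HB Require Import structures.
From mathcomp Require Import all_boot all_order all_algebra monoid.
From mathcomp Require Import all_classical all_reals all_analysis.

Set Implicit Arguments.
Unset Strict Implicit.
Unset Printing Implicit Defensive.

Import Order.TTheory GRing.Theory Num.Theory.

Local Open Scope classical_set_scope.
Local Open Scope ring_scope.

(* The library only has additive topological groups (topologicalZmodType),
   which are commutative. *)
HB.mixin Record Group_isTopologicalGroup G of Topological G & Group G := {
  mulg_continuous : continuous (fun p : G * G => (p.1 * p.2)%g) ;
  invg_continuous : continuous (fun x : G => (x^-1)%g)
}.

#[short(type="topologicalGroupType")]
HB.structure Definition TopologicalGroup :=
  {G of Topological G & Group G & Group_isTopologicalGroup G}.

Definition separable (T : topologicalType) : Prop :=
  exists2 S : set T, countable S & dense S.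

Definition is_metric (R : realType) (T : Type) (d : T -> T -> R) : Prop :=
  [/\ forall x y, 0 <= d x y,
      forall x y, d x y = 0 <-> x = y,
      forall x y, d x y = d y x &
      forall x y z, d x z <= d x y + d y z].

Definition metric_induces (R : realType) (T : topologicalType)
    (d : T -> T -> R) : Prop :=
  forall U : set T, open U <->
    forall x, U x -> exists2 e : R, 0 < e & [set y | d x y < e] `<=` U.

Definition metric_cauchy (R : realType) (T : Type) (d : T -> T -> R)
    (u : nat -> T) : Prop :=
  forall e : R, 0 < e ->
    exists N, forall m n, (N <= m)%N -> (N <= n)%N -> d (u m) (u n) < e.

Definition completely_metrizable (R : realType) (T : topologicalType) : Prop :=
  exists d : T -> T -> R,
    [/\ is_metric d, metric_induces d &
        forall u : nat -> T, metric_cauchy d u -> exists l : T, u @ \oo --> l].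

Definition polish (R : realType) (T : topologicalType) : Prop :=
  separable T /\ completely_metrizable R T.

Definition borel {T : topologicalType} : set (set T) := <<s @open T >>.

Definition borel_map (T U : topologicalType) (f : T -> U) : Prop :=
  forall B : set U, borel B -> borel (f @^-1` B).

Definition group_action (G : groupType) (X : Type) (act : G -> X -> X) : Prop :=
  (forall x, act 1%g x = x) /\
  (forall g h x, act (g * h)%g x = act g (act h x)).

(* G * X carries the product topology; for Polish G and X its Borel sets are
   those of the product sigma-algebra. *)
Definition borel_action (G : topologicalGroupType) (X : topologicalType)
    (act : G -> X -> X) : Prop :=
  group_action act /\ borel_map (fun p : G * X => act p.1 p.2).

Definition borel_partition (X : topologicalType) (I : Type)
    (A : set X) (F : I -> set X) : Prop :=
  [/\ forall i, borel (F i), trivIset setT F & A = \bigcup_i F i].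

(* The index type I may be empty, finite or infinite, and pieces may be
   empty. *)
Definition countable_equidecomposable (G : topologicalGroupType)
    (X : topologicalType) (act : G -> X -> X) (A B : set X) : Prop :=
  exists (I : countType) (F E : I -> set X) (g : I -> G),
    [/\ borel_partition A F, borel_partition B E &
        forall i, act (g i) @` F i = E i].

Definition countably_paradoxical (G : topologicalGroupType)
    (X : topologicalType) (act : G -> X -> X) : Prop :=
  exists A B : set X,
    [/\ borel A, borel B, A `&` B = set0,
        countable_equidecomposable act setT A &
        countable_equidecomposable act A B].

(* Measurable types of the library are pointed, whereas a Polish space may be
   empty. The base point x0 affects neither the topology nor the Borel sets, and
   a space carrying a probability measure is nonempty, so quantifying over x0
   together with the measure loses nothing. *)
Definition pointed_at (T : Type) (x0 : T) : Type := T.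

HB.instance Definition _ (T : topologicalType) (x0 : T) :=
  Topological.on (@pointed_at T x0).
HB.instance Definition _ (T : topologicalType) (x0 : T) :=
  isPointed.Build (@pointed_at T x0) x0.

Definition borelType (T : topologicalType) (x0 : T) :=
  g_sigma_algebraType (@open (pointed_at x0)).

Definition invariant_measure (G : topologicalGroupType) (X : topologicalType)
    (act : G -> X -> X) (R : realType) (mu : set X -> \bar R) : Prop :=
  forall (g : G) (A : set X), borel A -> mu A = mu (act g @` A).

(* Main.v *)
From HB Require Import structures.
Require Import Defs.
From mathcomp Require Import all_boot all_order all_algebra monoid.
From mathcomp Require Import lra.
From mathcomp Require Import all_classical all_reals all_analysis.

(* Call an invariant set null if infinitely many copies of it embed, piece by
   piece along orbits, into one copy. For a countable group of Borel
   automorphisms with a non-null space, compare n copies of a set A with k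
   copies of X: up to null sets this cuts X into the invariant part where A has
   density at least k/n and the rest, so outside a null set each point yields a
   finitely additive invariant content. Only countably many conditions can be
   imposed at one point; by an ultrafilter argument on a countable algebra,
   continuity along countably many well-chosen unions suffices for the content to
   extend to a measure. This gives a probability measure invariant under a
   countable dense subgroup H of G.

   For the passage from H to G, Vaught transforms {x | {g in U : gx in A} is
   nonmeager} vary semicontinuously under translation, so their measure is
   preserved by all of G. They separate points, hence generate the Borel sets up
   to null sets, and the measure is G-invariant. *)

(** The countable subgroup comes first because matchings run through a list of moves and null sets
    are stable only under countable unions, while [G] may be uncountable. This loses nothing on the
    paradoxical side: pieces moved by elements of H are moved by elements of G, and two of the
    infinitely many disjoint copies of a null space inside itself already serve as the sets [A] and
    [B].

    The measure is built from densities along the orbit of a single point. Comparing integer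
    multiples fixes n times a density only up to a bounded error, so every law of the content is
    first proved with a constant error and then divided by n.

    The ultrafilter argument serves twice: it turns the content into a measure, and it bounds the
    measure of the set on which the separating Vaught transforms fail to recover a given Borel set.
    Both times the ultrafilter avoids an exceptional set made of tails of countable unions, with
    geometrically decreasing bounds.

    The implication from (2) to (1) is additivity: disjoint [A] and [B] would both have measure
    1. *)

Set Implicit Arguments.
Unset Strict Implicit.
Unset Printing Implicit Defensive.

Import Order.TTheory GRing.Theory Num.Theory.

Local Open Scope classical_set_scope.

(** * Transport of multisets along orbits *)

Section measurable_predicates.
Context d (X : measurableType d).
Implicit Types P Q : X -> Prop.

Lemma measurable_and P Q : measurable [set x | P x] ->
  measurable [set x | Q x] -> measurable [set x | P x /\ Q x].
Proof. exact: measurableI. Qed.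

Lemma measurable_or P Q : measurable [set x | P x] ->
  measurable [set x | Q x] -> measurable [set x | P x \/ Q x].
Proof. exact: measurableU. Qed.

Lemma measurable_not P :
  measurable [set x | P x] -> measurable [set x | ~ P x].
Proof. exact: measurableC. Qed.

Lemma measurable_cstP (p : Prop) : measurable [set x : X | p].
Proof.
have [hp|hp] := pselect p.
  by rewrite (_ : mkset _ = setT) //; apply/seteqP; split.
by rewrite (_ : mkset _ = set0) //; apply/seteqP; split.
Qed.

Lemma measurable_exists (I : countType) (P : I -> X -> Prop) :
  (forall i, measurable [set x | P i x]) ->
  measurable [set x | exists i, P i x].
Proof.
move=> mP; rewrite (_ : mkset _ = \bigcup_i [set x | P i x]).
  exact: countable_bigcupT_measurable.
by apply/seteqP; split => x; [move=> [i ?]; exists i|move=> [i _ ?]; exists i].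
Qed.

Lemma measurable_forall (I : countType) (P : I -> X -> Prop) :
  (forall i, measurable [set x | P i x]) ->
  measurable [set x | forall i, P i x].
Proof.
move=> mP; rewrite (_ : mkset _ = [set x | ~ exists i, ~ P i x]).
  apply/measurable_not/measurable_exists => i; exact/measurable_not.
apply/seteqP; split => x /= h; first by move=> [i]; apply.
by move=> i; apply: contrapT => ?; apply: h; exists i.
Qed.

End measurable_predicates.

(** The natural numbers name the group elements, possibly with repetition. The group laws are
    therefore required of the maps only, not of the names. *)
Record countable_action d (X : measurableType d) := CountableAction {
  act_fun :> nat -> X -> X ;
  act_one : nat ;
  act_inv : nat -> nat ;
  act_mul : nat -> nat -> nat ;
  act1 : forall x, act_fun act_one x = x ;
  actM : forall a b x, act_fun (act_mul a b) x = act_fun a (act_fun b x) ;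
  actV : forall a x, act_fun (act_inv a) (act_fun a x) = x ;
  actVr : forall a x, act_fun a (act_fun (act_inv a) x) = x ;
  act_measurable : forall a A, measurable A -> measurable (act_fun a @^-1` A)
}.

Section transport.
Context d (X : measurableType d) (h : countable_action X).
Local Notation one := (act_one h).
Local Notation inv := (act_inv h).
Local Notation mul := (act_mul h).

(* A subset of [X * nat] is a multiset in [X], the second component numbering
   the copies; [send t] takes each of its points to another point of the same
   orbit, on a possibly different level. *)
Definition send (t : X * nat -> nat * nat) (y : X * nat) : X * nat :=
  (h (t y).1 y.1, (t y).2).

Definition mmeas (E : set (X * nat)) :=
  forall i, measurable [set x | E (x, i)].

(** A piecewise translation with countably many pieces, the level sets of [t]. Values of [t] outside
    [E] are junk, hence the relative measurability clause. *)
Definition transport (E F : set (X * nat)) (t : X * nat -> nat * nat) :=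
  [/\ forall i p, measurable [set x | E (x, i) /\ t (x, i) = p],
      forall y, E y -> F (send t y) &
      forall y y', E y -> E y' -> send t y = send t y' -> y = y'].

Definition embeds E F := exists t, transport E F t.

(** The multiple nA of the type semigroup. The offset [a] allows sums to be represented by disjoint
    blocks of levels. *)
Definition blk (A : set X) a n : set (X * nat) :=
  [set y | A y.1 /\ a <= y.2 < a + n].

Definition over (E : set (X * nat)) (S : set X) : set (X * nat) :=
  [set y | E y /\ S y.1].

Definition act_invariant (S : set X) := forall a x, S x -> S (h a x).

Lemma invariantE S a x : act_invariant S -> S (h a x) = S x.
Proof.
move=> iS; apply/propext; split; last exact: iS.
by move=> /(iS (inv a)); rewrite actV.
Qed.

Lemma invariantC S : act_invariant S -> act_invariant (~` S).
Proof. by move=> iS a x; rewrite /setC /= invariantE. Qed.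

Lemma invariantI S S' : act_invariant S -> act_invariant S' -> act_invariant (S `&` S').
Proof. by move=> iS iS' a x [? ?]; split; [exact: iS|exact: iS']. Qed.

Lemma invariant_bigcup I (D : set I) (S : I -> set X) :
  (forall i, act_invariant (S i)) -> act_invariant (\bigcup_(i in D) S i).
Proof. by move=> iS a x [i Di Sx]; exists i => //; exact: iS. Qed.

Lemma invariant_bigcap I (D : set I) (S : I -> set X) :
  (forall i, act_invariant (S i)) -> act_invariant (\bigcap_(i in D) S i).
Proof. by move=> iS a x Sx i Di; apply: iS; exact: Sx. Qed.

Lemma mmeas_over E S : mmeas E -> measurable S -> mmeas (over E S).
Proof. by move=> mE mS i; apply: measurable_and => //; exact: mE. Qed.

Lemma mmeasD E F : mmeas E -> mmeas F -> mmeas (E `\` F).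
Proof.
move=> mE mF i; apply: measurable_and; first exact: mE.
by apply: measurable_not; exact: mF.
Qed.

Lemma mmeas_bigcup (E : nat -> set (X * nat)) :
  (forall k, mmeas (E k)) -> mmeas (\bigcup_k E k).
Proof.
move=> mE i; rewrite (_ : mkset _ = [set x | exists k, E k (x, i)]).
  by apply: measurable_exists => k; exact: mE.
by apply/seteqP; split => x; [move=> [k _ ?]; exists k|move=> [k ?]; exists k].
Qed.

Lemma mmeas_blk A a n : measurable A -> mmeas (blk A a n).
Proof.
by move=> mA i; apply: measurable_and => //=; exact: measurable_cstP.
Qed.

Lemma transport_mmeas E F t : transport E F t -> mmeas E.
Proof.
move=> [mE _ _] i.
rewrite (_ : mkset _ = [set x | exists p, E (x, i) /\ t (x, i) = p]).
  by apply: measurable_exists => p; exact: mE.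
by apply/seteqP; split => x /=; [move=> Ex; exists (t (x, i))|move=> [p []]].
Qed.

Lemma transport_sub E F E' t : transport E F t -> mmeas E' -> E' `<=` E ->
  transport E' F t.
Proof.
move=> [mE EF inj] mE' sE; split.
- move=> i p; rewrite (_ : mkset _ =
    [set x | E' (x, i) /\ (E (x, i) /\ t (x, i) = p)]).
    by apply: measurable_and; [exact: mE'|exact: mE].
  by apply/seteqP; split => x /=; [move=> [/[dup] /sE ? ? ?]|move=> [? []]].
- by move=> y /sE; exact: EF.
- by move=> y y' /sE ? /sE ?; exact: inj.
Qed.

Lemma transport_cod E F F' t : transport E F t ->
  (forall y, E y -> F' (send t y)) -> transport E F' t.
Proof. by move=> [? ? ?] EF'; split. Qed.

Lemma embeds_subl E E' F : mmeas E' -> E' `<=` E -> embeds E F -> embeds E' F.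
Proof. by move=> mE' sE [t tEF]; exists t; exact: transport_sub sE. Qed.

Lemma embeds_subr E F F' : F `<=` F' -> embeds E F -> embeds E F'.
Proof.
move=> sF [t tEF]; exists t; apply: (transport_cod tEF) => y Ey.
by apply: sF; case: tEF => _ + _; apply.
Qed.

Lemma embeds_refl E : mmeas E -> embeds E E.
Proof.
move=> mE; exists (fun y => (one, y.2)); split.
- by move=> i p; apply: measurable_and => /=; [exact: mE|exact: measurable_cstP].
- by move=> [x i] Ey; rewrite /send /= act1.
- by move=> [x i] [x' i'] _ _; rewrite /send /= !act1.
Qed.

Lemma embeds_sub E F : mmeas E -> E `<=` F -> embeds E F.
Proof. by move=> mE sEF; apply: embeds_subr sEF _; exact: embeds_refl. Qed.

Definition tcomp (t2 t1 : X * nat -> nat * nat) y :=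
  (mul (t2 (send t1 y)).1 (t1 y).1, (t2 (send t1 y)).2).

Lemma send_tcomp t2 t1 y : send (tcomp t2 t1) y = send t2 (send t1 y).
Proof. by rewrite /send /tcomp /= actM. Qed.

Lemma transport_comp E F K t1 t2 : transport E F t1 -> transport F K t2 ->
  transport E K (tcomp t2 t1).
Proof.
move=> [m1 EF i1] [m2 FK i2]; split.
- move=> i p; rewrite (_ : mkset _ = [set x | exists q : (nat * nat) * (nat * nat),
    (E (x, i) /\ t1 (x, i) = q.1) /\
    ((F (h q.1.1 x, q.1.2) /\ t2 (h q.1.1 x, q.1.2) = q.2) /\
     p = (mul q.2.1 q.1.1, q.2.2))]).
    apply: measurable_exists => -[p1 p2] /=.
    apply: measurable_and; first exact: m1.
    apply: measurable_and; last exact: measurable_cstP.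
    exact: act_measurable (m2 _ _).
  apply/seteqP; split => x /=.
    move=> [Ex <-]; exists (t1 (x, i), t2 (send t1 (x, i))) => /=.
    by split => //; split => //; split => //; exact: EF.
  by move=> [[p1 p2] /= [[Ex e1] [[Fx e2] ->]]]; rewrite /tcomp /send /= e1 e2.
- by move=> y Ey; rewrite send_tcomp; apply: FK; exact: EF.
- move=> y y' Ey Ey'; rewrite !send_tcomp => e.
  by apply: i1 => //; apply: i2 => //; exact: EF.
Qed.

Lemma embeds_trans F E K : embeds E F -> embeds F K -> embeds E K.
Proof.
by move=> [t1 h1'] [t2 h2]; exists (tcomp t2 t1); exact: transport_comp h2.
Qed.

(* Points lying in several [E k] are moved by the transport of least index. *)
Lemma embeds_bigcup (E F : nat -> set (X * nat)) :
  (forall k, embeds (E k) (F k)) -> trivIset setT F ->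
  embeds (\bigcup_k E k) (\bigcup_k F k).
Proof.
move=> /choice[t tP] tF.
have mE k : mmeas (E k) := transport_mmeas (tP k).
pose first y k := E k y /\ forall l, l < k -> ~ E l y.
have firstP y : (\bigcup_k E k) y -> exists k, first y k.
  move=> [k _]; elim/ltn_ind: k => k IH Ek.
  have [[l [lk El]]|nl] := pselect (exists l, l < k /\ E l y).
    exact: IH El.
  by exists k; split => // l lk El; apply: nl; exists l.
have first_inj y k l : first y k -> first y l -> k = l.
  move=> [Ek nk] [El nl]; apply/eqP; rewrite eqn_leq.
  by apply/andP; split; rewrite leqNgt; apply/negP; [move=> /nk|move=> /nl].
have /choice[c cP] : forall y, exists k, (\bigcup_k E k) y -> first y k.
  move=> y; have [/firstP[k ?]|nE] := pselect ((\bigcup_k E k) y).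
    by exists k.
  by exists 0 => /nE.
exists (fun y => t (c y) y); split.
- move=> i p; rewrite (_ : mkset _ = [set x | exists k,
    (E k (x, i) /\ t k (x, i) = p) /\ forall l, l < k -> ~ E l (x, i)]).
    apply: measurable_exists => k; apply: measurable_and.
      by have [+ _ _] := tP k; apply.
    apply: measurable_forall => l.
    have [lk|lk] := boolP (l < k); last first.
      by rewrite (_ : mkset _ = setT)//; apply/seteqP; split.
    rewrite (_ : mkset _ = [set x | ~ E l (x, i)]).
      by apply: measurable_not; exact: mE.
    by apply/seteqP; split => x /=; [exact|].
  apply/seteqP; split => x /=.
    by move=> [xE <-]; exists (c (x, i)); have [] := cP _ xE.
  move=> [k [[Ek <-] nk]]; have xE : (\bigcup_k E k) (x, i) by exists k.
  by split=> //; rewrite (first_inj _ _ _ (cP _ xE) (conj Ek nk)).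
- move=> y yE; exists (c y) => //; have [Ec _] := cP _ yE.
  by have [_ + _] := tP (c y); apply.
- move=> y y' yE y'E e; have [Ec _] := cP _ yE; have [Ec' _] := cP _ y'E.
  have [_ EF inj] := tP (c y); have [_ EF' _] := tP (c y').
  have ecc : c y = c y'.
    apply: (tF _ _ I I); exists (send (t (c y)) y); split; first exact: EF.
    rewrite [X in F _ X](_ : _ = send (t (c y')) y') //; exact: EF'.
  apply: inj => //; first by rewrite ecc.
  by move: e; rewrite /send -ecc.
Qed.

Lemma embeds_bigcup_sub (E F : nat -> set (X * nat)) E' F' :
  mmeas E' -> E' `<=` \bigcup_k E k -> (forall k, F k `<=` F') ->
  (forall k, embeds (E k) (F k)) -> trivIset setT F -> embeds E' F'.
Proof.
move=> mE' sE sF lEF tF; have l := embeds_bigcup lEF tF.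
apply: embeds_subl mE' sE _; apply: embeds_subr l.
by apply: bigcup_sub => k _; exact: sF.
Qed.

Lemma embedsU E1 E2 F1 F2 : embeds E1 F1 -> embeds E2 F2 -> F1 `&` F2 = set0 ->
  embeds (E1 `|` E2) (F1 `|` F2).
Proof.
move=> l1 l2 d12; rewrite -!bigcup2E; apply: embeds_bigcup.
  move=> [|[|k]] //=; apply: embeds_sub => //.
  by move=> i; rewrite (_ : mkset _ = set0)//.
by rewrite -trivIset_bigcup2 // /disj_set; apply/trivIset_bigcup2.
Qed.

(** Transports move points inside their orbits, so they restrict to any invariant set. *)
Lemma embeds_over E F S : act_invariant S -> measurable S -> embeds E F ->
  embeds (over E S) (over F S).
Proof.
move=> iS mS [t tEF]; exists t.
have mE := transport_mmeas tEF.
have tE' : transport (over E S) F t.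
  by apply: (transport_sub tEF); [exact: mmeas_over|move=> y []].
apply: (transport_cod tE') => y [Ey Sy]; split; last exact: iS.
by case: tEF => _ + _; apply.
Qed.

Lemma embeds_shift A a b n : measurable A -> embeds (blk A a n) (blk A b n).
Proof.
move=> mA; exists (fun y => (one, y.2 - a + b)); split.
- move=> i p; apply: measurable_and => /=; last exact: measurable_cstP.
  exact: mmeas_blk.
- move=> [x i] [/= Ax /andP[ai ian]]; rewrite /send /blk /= act1; split=> //.
  by rewrite leq_addl /= addnC ltn_add2l ltn_subLR.
- move=> [x i] [x' i'] [/= Ax /andP[ai ian]] [/= Ax' /andP[ai' ian']].
  rewrite /send /= !act1 => -[-> /addIn e]; congr (_, _).
  by rewrite -(subnK ai) e subnK.
Qed.

Lemma blkD A n m : blk A 0 (n + m) = blk A 0 n `|` blk A n m.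
Proof.
apply/seteqP; split => -[x i]; rewrite /blk /= !add0n.
  by move=> [Ax inm]; have [?|?] := ltnP i n; [left|right].
by move=> [[Ax /ltn_addr ->]|[Ax /andP[_ ->]]].
Qed.

Lemma blk_disj A B n m : blk A 0 n `&` blk B n m = set0.
Proof.
apply/seteqP; split => // -[x i] [[/= _ +] [/= _ /andP[+ _]]].
by rewrite add0n => i1 i2; move: (leq_trans i1 i2); rewrite ltnn.
Qed.

Lemma blk_disjl A B a n b m : A `&` B = set0 -> blk A a n `&` blk B b m = set0.
Proof.
move=> AB; apply/seteqP; split => // -[x i] [[/= Ax _] [/= Bx _]].
by have : (A `&` B) x by []; rewrite AB.
Qed.

Lemma blk_sub A B n m : A `<=` B -> n <= m -> blk A 0 n `<=` blk B 0 m.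
Proof.
move=> AB nm [x i] [/= Ax]; rewrite /blk /= !add0n => i_n.
by split; [exact: AB|exact: leq_trans nm].
Qed.

Lemma over_blk A S a n : over (blk A a n) S = blk (A `&` S) a n.
Proof. by apply/seteqP; split => -[x i] /=; rewrite /over /blk /=; tauto. Qed.

Lemma embeds_scale A B n k m : measurable A -> measurable B ->
  embeds (blk A 0 k) (blk B 0 n) -> embeds (blk A 0 (m * k)) (blk B 0 (m * n)).
Proof.
move=> mA mB l; elim: m => [|m IH].
  apply: embeds_sub; first exact: mmeas_blk.
  by move=> [x i] [/= _]; rewrite mul0n.
rewrite !mulSn ![_ + m * _]addnC !blkD; apply: embedsU => //; last exact: blk_disj.
apply: embeds_trans (embeds_shift (m * k) 0 k mA) _.
by apply: embeds_trans l _; exact: embeds_shift.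
Qed.

Lemma embeds_addl S A B n k l : measurable S -> A `&` B = set0 ->
  embeds (blk S 0 k) (blk A 0 n) -> embeds (blk S 0 l) (blk B 0 n) ->
  embeds (blk S 0 (k + l)) (blk (A `|` B) 0 n).
Proof.
move=> mS AB lA lB; rewrite blkD; apply: (@embeds_subr _ (blk A 0 n `|` blk B 0 n)).
  by move=> [x i] [|] [/= ? ?]; split => //; [left|right].
apply: embedsU => //; last exact: blk_disjl.
by apply: embeds_trans lB; exact: embeds_shift.
Qed.

Lemma embeds_addr S A B n k l : measurable A -> measurable B -> measurable S ->
  embeds (blk A 0 n) (blk S 0 k) -> embeds (blk B 0 n) (blk S 0 l) ->
  embeds (blk (A `|` B) 0 n) (blk S 0 (k + l)).
Proof.
move=> mA mB mS lA lB.
apply: (@embeds_subl (blk A 0 n `|` blk B 0 n)).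
- by apply: mmeas_blk; exact: measurableU.
- by move=> [x i] [/= [?|?] ?]; [left|right].
rewrite blkD; apply: embedsU => //; last exact: blk_disj.
by apply: embeds_trans lB _; exact: embeds_shift.
Qed.

End transport.

(** * Null sets and maximal matchings *)

Section null_sets.
Context d (X : measurableType d) (h : countable_action X).
Local Notation one := (act_one h).
Local Notation inv := (act_inv h).
Local Notation mul := (act_mul h).
Local Notation embeds := (embeds h).
Local Notation send := (send h).
Local Notation transport := (transport h).
Local Notation invariant := (act_invariant h).

Definition copies (S : set X) : set (X * nat) := [set y | S y.1].

Lemma mmeas_copies S : measurable S -> mmeas (copies S).
Proof. by move=> mS i; exact: mS. Qed.

(** Compressibility of the action on [S], stated with infinitely many copies so that countable
    unions and saturations are handled by renumbering levels. *)
Definition null (S : set X) :=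
  [/\ invariant S, measurable S & embeds (copies S) (blk S 0 1)].

Lemma null_of_embeds S : invariant S -> measurable S ->
  embeds (copies S) (blk setT 0 1) -> null S.
Proof.
move=> iS mS /(embeds_over iS mS) l; split => //.
rewrite over_blk setTI in l; apply: embeds_subl l => // -[x i] ?; split => //.
Qed.

Lemma null_sub S S' : null S -> invariant S' -> measurable S' -> S' `<=` S ->
  null S'.
Proof.
move=> [_ _ l] iS' mS' sS; apply: null_of_embeds => //.
apply: embeds_subr (embeds_subl _ _ l) => //; first by move=> [x i] [].
by move=> [x i]; exact: sS.
Qed.

Lemma invariant_seqDU (S : nat -> set X) k :
  (forall k, invariant (S k)) -> invariant (seqDU S k).
Proof.
move=> iS; apply: invariantI => //; apply: invariantC.
by elim/big_rec: _ => // i A _ iA a x [?|?]; [left; exact: iS|right; exact: iA].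
Qed.

Lemma null_bigcup (S : nat -> set X) :
  (forall k, null (S k)) -> null (\bigcup_k S k).
Proof.
move=> nS; have iS k : invariant (S k) by have [] := nS k.
have mS k : measurable (S k) by have [] := nS k.
have nD k : null (seqDU S k).
  apply: null_sub (nS k) _ _ _; first exact: invariant_seqDU.
    exact: seqDU_measurable.
  exact: subset_seqDU.
apply: null_of_embeds; [exact: invariant_bigcup|exact: bigcup_measurable|].
rewrite seqDU_bigcup_eq.
apply: (@embeds_bigcup_sub _ _ h (fun k => copies (seqDU S k))
    (fun k => blk (seqDU S k) 0 1)).
- apply: mmeas_copies; apply: bigcupT_measurable => k.
  exact: seqDU_measurable.
- by move=> [x i] [k _ ?]; exists k.
- by move=> k [x i] [? ?]; split.
- by move=> k; have [] := nD k.
- move=> i j _ _ [[x k] [[/= xi _] [/= xj _]]].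
  by apply: (@trivIset_seqDU _ S i j) => //; exists x.
Qed.

Definition msat (E : set (X * nat)) : set X :=
  [set x | exists n i, E (h n x, i)].

Lemma sub_msat E x i : E (x, i) -> msat E x.
Proof. by move=> Ex; exists one, i; rewrite act1. Qed.

Lemma invariant_msat E : invariant (msat E).
Proof.
move=> a x [n [i Ex]]; exists (mul n (inv a)), i.
by rewrite actM actV.
Qed.

Lemma measurable_msat E : mmeas E -> measurable (msat E).
Proof.
move=> mE; apply: measurable_exists => n; apply: measurable_exists => i.
exact: act_measurable (mE i).
Qed.

Definition sat (A : set X) := msat (copies A).

Lemma invariant_sat A : invariant (sat A).
Proof. exact: invariant_msat. Qed.

Lemma measurable_sat A : measurable A -> measurable (sat A).
Proof. by move=> mA; exact: measurable_msat. Qed.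

(** The target is the image of [P] under [h n], written as a preimage under the inverse because
    measurability is assumed for preimages. *)
Lemma embeds_single (P : set X) i n j :
  measurable P -> embeds [set y | P y.1 /\ y.2 = i]
    [set y | P (h (inv n) y.1) /\ y.2 = j].
Proof.
move=> mP; exists (fun=> (n, j)); split.
- move=> k p; apply: measurable_and => /=; last exact: measurable_cstP.
  by apply: measurable_and => //; exact: measurable_cstP.
- by move=> [x k] [/= Px _]; rewrite /send /= actV.
- move=> [x k] [x' k'] [/= _ ->] [/= _ ->] [e].
  by rewrite -(actV h n x) e actV.
Qed.

Lemma embeds_single_inv (P : set X) i n j :
  measurable P -> embeds [set y | P (h (inv n) y.1) /\ y.2 = j]
    [set y | P y.1 /\ y.2 = i].
Proof.
move=> mP; have l := embeds_single j (inv n) i (act_measurable h (inv n) mP).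
apply: embeds_subr l => -[x k] [/= + ->].
by rewrite actVr.
Qed.

(** Countably many moves bring the saturation into [A]. The infinitely many copies of [A] absorb all
    of them when copy [i] under move [k] is sent to level [pickle (k, i)]. *)
Lemma null_sat A : measurable A -> embeds (copies A) (blk setT 0 1) -> null (sat A).
Proof.
move=> mA l; apply: null_of_embeds; [exact: invariant_sat|exact: measurable_sat|].
apply: embeds_trans _ l.
pose E (k : nat) : set (X * nat) := [set y | A (h k y.1)].
pose F (k : nat) : set (X * nat) :=
  [set y | exists i : nat, A y.1 /\ y.2 = pickle (k, i)].
apply: (embeds_bigcup_sub (E := E) (F := F)).
- by apply/mmeas_copies; exact: measurable_sat.
- by move=> [x i] [k [j Ax]]; exists k.
- by move=> k [x i] [j [? _]].
- move=> k; exists (fun y => (k, pickle (k, y.2))); split.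
  + move=> i p; apply: measurable_and => /=; last exact: measurable_cstP.
    exact: act_measurable.
  + by move=> [x i] Ax; exists i.
  + move=> [x i] [x' i'] _ _ [e /(pcan_inj pickleK)[->]]; congr (_, _).
    by rewrite -(actV h k x) e actV.
- move=> k l' _ _ [[x i] [[j [_ /= ->]] [j' [_ /= /(pcan_inj pickleK)[]]]]].
  by [].
Qed.

Section pigeonhole.
Variables (lam : nat -> nat) (j : nat).

(** At a time when [lam] is at [j], this is the rank of that visit, so infinitely many visits are
    numbered by all of 0, 1, 2 and so on. *)
Fixpoint visits n :=
  if n is m.+1 then visits m + (lam m == j) else 0.

Lemma visits_next m n : m <= n -> lam n = j ->
  exists k, lam k = j /\ visits k = visits m.
Proof.
move=> /subnK <-; move: (n - m) => k; elim: k m => [|k IH] m e.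
  by exists m; rewrite add0n in e.
have [e'|ne] := eqVneq (lam m) j; first by exists m.
have [|k' [? ek']] := IH m.+1; first by rewrite addnS -addSn.
by exists k'; split => //; rewrite ek' /= (negbTE ne) addn0.
Qed.

Lemma visits_onto : (forall m, exists n, m <= n /\ lam n = j) ->
  forall i, exists n, lam n = j /\ visits n = i.
Proof.
move=> io; elim=> [|i [n [en vn]]].
  by have [n [n0 e]] := io 0; have [k [? ?]] := visits_next n0 e; exists k.
have [m [nm e]] := io n.+1; have [k [? ek]] := visits_next nm e.
by exists k; split => //; rewrite ek /= en eqxx vn addn1.
Qed.

End pigeonhole.

(* Iterating an injection of [l.+1] copies of [S] into [l] copies on the extra
   copy yields infinitely many disjoint copies of [S]; along the copies, the
   levels met by a given point repeat infinitely often. *)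
Lemma null_of_shrink S l : invariant S -> measurable S ->
  embeds (blk S 0 l.+1) (blk S 0 l) -> null S.
Proof.
move=> iS mS [t tS].
(* [it n] is the power n+1 of the injection, to be applied to the extra copy at level [l]. *)
pose it := fix it n := if n is m.+1 then tcomp h t (it m) else t.
have tS1 : transport (blk S l 1) (blk S 0 l) t.
  apply: (transport_sub tS); first exact: mmeas_blk.
  by move=> [x i] [/= ? /andP[_ il]]; split => //=; rewrite addn1 in il.
have blkS : blk S 0 l `<=` blk S 0 l.+1 by apply: blk_sub.
have itS n : transport (blk S l 1) (blk S 0 l) (it n).
  elim: n => //= n IH; apply: transport_comp IH _.
  by apply: (transport_sub tS) => //; exact: mmeas_blk.
have blkl x : S x -> blk S l 1 (x, l) by move=> ?; split => //=; rewrite addn1 !leqnn.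
have it_in n x : S x -> blk S 0 l (send (it n) (x, l)).
  by move=> Sx; have [_ + _] := itS n; apply; exact: blkl.
(* By injectivity, common applications of [t] can be cancelled until one side is a point of level
   [l], which is never a value of [t]. *)
have it_neq n m x x' : S x -> S x' -> n < m ->
    send (it n) (x, l) <> send (it m) (x', l).
  have [_ _ inj] := tS.
  elim: n m x x' => [|n IH] [|m] // x x' Sx Sx' nm /=.
    rewrite send_tcomp => /inj e.
    have : blk S 0 l (x, l).
      rewrite e; first exact: it_in.
        by split => //=; rewrite add0n.
      by apply: blkS; exact: it_in.
    by move=> [_ /=]; rewrite add0n ltnn.
  rewrite !send_tcomp => /inj e.
  by apply: (IH m x x') => //; apply: e; apply: blkS; exact: it_in.
pose lam x n := (it n (x, l)).2.
have mlam n q : measurable [set x | S x /\ lam x n = q].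
  rewrite (_ : mkset _ = [set x | exists p : nat * nat,
    (blk S l 1 (x, l) /\ it n (x, l) = p) /\ p.2 = q]).
    apply: measurable_exists => p; apply: measurable_and.
      by have [+ _ _] := itS n; apply.
    exact: measurable_cstP.
  apply/seteqP; split => x /=; first by move=> [/blkl ? ?]; exists (it n (x, l)).
  by move=> [p [[[? _] <-]]].
(* The points whose iterates visit level [j] infinitely often; the saturations of these sets will
   cover [S]. *)
pose A j := [set x | S x /\ forall m, exists n, m <= n /\ (S x /\ lam x n = j)].
have mA j : measurable (A j).
  apply: measurable_and => //; apply: measurable_forall => m.
  apply: measurable_exists => n; apply: measurable_and => //.
  exact: measurable_cstP.
have mvis j n i : measurable [set x | S x /\ visits (lam x) j n = i].
  elim: n i => [|n IH] i /=.
    by apply: measurable_and => //; exact: measurable_cstP.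
  rewrite (_ : mkset _ = [set x | exists q : nat * nat,
     ((S x /\ visits (lam x) j n = q.1) /\ (S x /\ lam x n = q.2)) /\
     q.1 + (q.2 == j) = i]).
    apply: measurable_exists => q; apply: measurable_and.
      by apply: measurable_and; [exact: IH|exact: mlam].
    exact: measurable_cstP.
  apply/seteqP; split => x /=.
    by move=> [Sx <-]; exists (visits (lam x) j n, lam x n).
  by move=> [[a b] /= [[[Sx <-] [_ <-]] <-]].
have nA j : null (sat (A j)).
  apply: null_sat => //.
  (* Copy number [i] of a point follows the iterates up to its visit of rank [i] to level [j]. All
     visits are then lowered to level 0, where different times still have disjoint images. *)
  pose E n : set (X * nat) := [set y | A j y.1 /\
    (S y.1 /\ lam y.1 n = j) /\ (S y.1 /\ visits (lam y.1) j n = y.2)].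
  pose F n : set (X * nat) := [set y | y.2 = 0 /\
    exists x, S x /\ send (it n) (x, l) = (y.1, j)].
  apply: (embeds_bigcup_sub (E := E) (F := F)).
  - exact/mmeas_copies.
  - move=> [x i] Ax; have [Sx io] := Ax.
    have [|n [e1 e2]] := @visits_onto (lam x) j _ i; last by exists n.
    by move=> m; have [n [? [? ?]]] := io m; exists n.
  - by move=> n [x i] [/= -> _].
  - move=> n; have [mit _ inj] := itS n.
    exists (fun y => ((it n (y.1, l)).1, 0)); split.
    + move=> i p /=; rewrite (_ : mkset _ = [set x | E n (x, i) /\
        exists q, (blk S l 1 (x, l) /\ it n (x, l) = q) /\ (q.1, 0) = p]).
        apply: measurable_and; last first.
          apply: measurable_exists => q; apply: measurable_and; first exact: mit.
          exact: measurable_cstP.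
        apply: measurable_and; first exact: mA.
        by apply: measurable_and => /=; [exact: mlam|exact: mvis].
      apply/seteqP; split => x /=.
        move=> [Ex e]; split => //; exists (it n (x, l)); split => //.
        by split => //; apply: blkl; case: Ex => -[].
      by move=> [Ex [q [[_ <-] ?]]].
    + move=> [x i] [/= Ax [[Sx e] _]]; split => //=; exists x; split => //.
      by rewrite /send /= -e.
    + move=> [x i] [x' i'] [/= _ [[Sx e1] [_ e2]]] [/= _ [[Sx' e1'] [_ e2']]].
      rewrite /send /= => -[e].
      have : (x, l) = (x', l).
        apply: inj; [exact: blkl|exact: blkl|].
        by rewrite /send /= -/(lam x n) -/(lam x' n) e e1 e1'.
      by move=> [xx']; rewrite -e2 -e2' xx'.
  - move=> n m _ _ [[x i] [[/= _ [y [Sy e]]] [/= _ [y' [Sy' e']]]]].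
    have [nm|mn|//] := ltngtP n m.
      by case: (it_neq n m y y' Sy Sy' nm); rewrite e.
    by case: (it_neq m n y' y Sy' Sy mn); rewrite e.
apply: null_sub (null_bigcup nA) iS mS _ => x Sx; apply: contrapT => nx.
have /choice[m mP] : forall j, exists m, forall n, m <= n -> lam x n <> j.
  move=> j; apply: contrapT => nm; apply: nx; exists j => //.
  apply: (@sub_msat _ x 0); split => // m; apply: contrapT => nn.
  by apply: nm; exists m => n mn e; apply: nn; exists n.
(* Otherwise each level is visited only before some time [m j]; at time [M] no level below [l] would
   remain, though all iterates live there. *)
pose M := \max_(j < l) m j; have [_ /=] := it_in M x Sx.
rewrite add0n => lM; apply: (mP (lam x M) M) => //.
exact: (@leq_bigmax _ (fun j : 'I_l => m j) (Ordinal lM)).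
Qed.

(* Greedy matching: run through all moves (from level [i] to level [j] by [h n])
   and perform each one wherever source and target are still free. *)
Lemma greedy_matching E F : mmeas E -> mmeas F -> exists D D',
  [/\ mmeas D /\ mmeas D', D `<=` E /\ D' `<=` F, embeds D D', embeds D' D &
      forall x i n j, E (x, i) -> ~ D (x, i) -> F (h n x, j) -> D' (h n x, j)].
Proof.
move=> mE mF.
(* A number that codes no move repeats the move (0, 0, 0), which is harmless because only free
   points are matched. *)
pose dec s : nat * nat * nat := odflt (0, 0, 0) (unpickle s).
pose P s (D : set (X * nat) * set (X * nat)) : set X :=
  let: (i, n, j) := dec s in
  [set x | (E (x, i) /\ ~ D.1 (x, i)) /\ (F (h n x, j) /\ ~ D.2 (h n x, j))].
pose src s (D : set (X * nat) * set (X * nat)) : set (X * nat) :=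
  [set y | P s D y.1 /\ y.2 = (dec s).1.1].
pose tgt s (D : set (X * nat) * set (X * nat)) : set (X * nat) :=
  [set y | P s D (h (inv (dec s).1.2) y.1) /\ y.2 = (dec s).2].
pose st := fix st s := if s is r.+1 then
  ((st r).1 `|` src r (st r), (st r).2 `|` tgt r (st r)) else (set0, set0).
have mP s D : mmeas D.1 -> mmeas D.2 -> measurable (P s D).
  move=> mD1 mD2; rewrite /P; case: (dec s) => -[i n] j.
  apply: measurable_and; first exact: mmeasD.
  exact: act_measurable (mmeasD mF mD2 j).
have m1 (Q : set X) i : measurable Q -> mmeas [set y | Q y.1 /\ y.2 = i].
  by move=> mQ k; apply: measurable_and => //=; exact: measurable_cstP.
have mst s : mmeas (st s).1 /\ mmeas (st s).2.
  elim: s => [|s [IH1 IH2]] /=; first by split=> i; exact: measurable0.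
  split => i; apply: measurable_or => //; first exact: (m1 _ _ (mP s (st s) IH1 IH2) i).
  exact: (m1 [set x | P s (st s) (h (inv (dec s).1.2) x)] _
    (act_measurable _ _ (mP _ _ IH1 IH2)) i).
have msrc s : mmeas (src s (st s)).
  by apply: m1; apply: mP; case: (mst s).
have mtgt s : mmeas (tgt s (st s)).
  apply: (m1 [set x | P s (st s) (h (inv (dec s).1.2) x)]).
  by apply: act_measurable; apply: mP; case: (mst s).
have st_src s y : (st s).1 y -> exists r, src r (st r) y.
  by elim: s => //= s IH [/IH|] //; exists s.
have st_tgt s y : (st s).2 y -> exists r, tgt r (st r) y.
  by elim: s => //= s IH [/IH|] //; exists s.
have src_st r s y : r < s -> src r (st r) y -> (st s).1 y.
  elim: s => // s IH; rewrite ltnS leq_eqVlt => /predU1P[->|rs] ry /=.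
    by right.
  by left; exact: IH.
have tgt_st r s y : r < s -> tgt r (st r) y -> (st s).2 y.
  elim: s => // s IH; rewrite ltnS leq_eqVlt => /predU1P[->|rs] ry /=.
    by right.
  by left; exact: IH.
have srcE s y : src s (st s) y -> E y /\ ~ (st s).1 y.
  by case: y => x i; rewrite /src /P /=; case: (dec s) => -[? ?] ? [[[? ?] _] ->].
have tgtF s y : tgt s (st s) y -> F y /\ ~ (st s).2 y.
  case: y => x i; rewrite /tgt /P /=; case: (dec s) => -[? ?] ? [[_ +] ->] /=.
  by rewrite actVr.
have triv (K : nat -> set (X * nat)) (T : nat -> set (X * nat)) :
    (forall r s y, r < s -> K r y -> T s y) -> (forall s y, K s y -> ~ T s y) ->
    trivIset setT K.
  move=> KT KnT i j _ _ [y [yi yj]]; have [ij|ji|//] := ltngtP i j.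
    by case: (KnT _ _ yj); exact: KT yi.
  by case: (KnT _ _ yi); exact: KT yj.
exists (\bigcup_s src s (st s)), (\bigcup_s tgt s (st s)); split.
- by split; exact: mmeas_bigcup.
- by split => y [s _]; [move/srcE => -[]|move/tgtF => -[]].
- apply: embeds_bigcup => [s|].
    by apply: embeds_single; apply: mP; case: (mst s).
  by apply: (triv _ (fun s => (st s).2)) => // s y /tgtF[].
- apply: embeds_bigcup => [s|].
    by apply: embeds_single_inv; apply: mP; case: (mst s).
  by apply: (triv _ (fun s => (st s).1)) => // s y /srcE[].
- move=> x i n j Ex Dx Fx; apply: contrapT => D'x.
  pose s := pickle (i, n, j).
  have ds : dec s = (i, n, j) by rewrite /dec pickleK.
  (* If source and target both stayed free for ever, they were free at stage [s], which would then
     have matched them. *)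
  apply: (Dx); exists s => //; rewrite /src /P ds /=; split => //; split; split => //.
    by move/st_src => [r ?]; apply: Dx; exists r.
  by move/st_tgt => [r ?]; apply: D'x; exists r.
Qed.

End null_sets.

(** * Density cuts *)

Section cuts.
Context d (X : measurableType d) (h : countable_action X).
Local Notation inv := (act_inv h).
Local Notation embeds := (embeds h).
Local Notation invariant := (act_invariant h).
Local Notation null := (null h).
Local Notation msat := (msat h).

(** After a maximal matching no orbit keeps free points of both [E] and [F]. The set [P] consists of
    the orbits in which [E] is used up; in every other orbit [F] is. *)
Lemma embeds_comparison E F : mmeas E -> mmeas F ->
  exists P, [/\ invariant P, measurable P, embeds (over E P) F &
                embeds (over F (~` P)) E].
Proof.
move=> mE mF; have [D [D' [[mD mD'] [DE D'F] DD' D'D sep]]] :=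
  greedy_matching h mE mF.
have mED : mmeas (E `\` D) by exact: mmeasD.
have mP : measurable (~` msat (E `\` D)).
  by apply: measurableC; exact: measurable_msat.
exists (~` msat (E `\` D)); split => //.
- by apply: invariantC; exact: invariant_msat.
- apply: embeds_subr D'F _; apply: embeds_subl DD'; first exact: mmeas_over.
  move=> [x i] [Ex nx]; apply: contrapT => Dx; apply: nx.
  exact: (@sub_msat _ _ _ _ _ i).
- apply: embeds_subr DE _; apply: embeds_subl D'D.
    by apply: mmeas_over => //; exact: measurableC.
  move=> [x j] [Fx]; rewrite setCK => -[n [i [Ex Dx]]].
  by have := sep _ _ (inv n) j Ex Dx; rewrite actV; exact.
Qed.

(* The [E r] are matched successively into what is left of [F]; on [Q r] the
   set [F] is used up before [E r] is. *)
Lemma embeds_sigma_comparison (E : nat -> set (X * nat)) F :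
  (forall r, mmeas (E r)) -> trivIset setT E -> mmeas F ->
  exists Q : nat -> set X,
  [/\ forall r, invariant (Q r), forall r, measurable (Q r),
      embeds (over (\bigcup_r E r) (~` \bigcup_r Q r)) F &
      forall r, embeds (over F (Q r)) (\bigcup_(i in `I_r.+1) E i)].
Proof.
move=> mE tE mF.
have /choice[g gP] : forall EF : set (X * nat) * set (X * nat), exists DD',
    mmeas EF.1 -> mmeas EF.2 ->
    [/\ mmeas DD'.1 /\ mmeas DD'.2, DD'.1 `<=` EF.1 /\ DD'.2 `<=` EF.2,
      embeds DD'.1 DD'.2, embeds DD'.2 DD'.1 &
      forall x i n j, EF.1 (x, i) -> ~ DD'.1 (x, i) ->
        EF.2 (h n x, j) -> DD'.2 (h n x, j)].
  move=> [E1 F1] /=; have [m1|?] := pselect (mmeas E1); last first.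
    by exists (set0, set0).
  have [m2|?] := pselect (mmeas F1); last by exists (set0, set0).
  by have [D [D' ?]] := greedy_matching h m1 m2; exists (D, D').
(* [Fs r] is what the first [r] rounds leave of [F]; [Q r] below collects the orbits where round [r]
   leaves a point of [E r] unmatched, so that [F] is exhausted there. *)
pose Fs := fix Fs r := if r is s.+1 then Fs s `\` (g (E s, Fs s)).2 else F.
have mFs r : mmeas (Fs r).
  elim: r => //= r IH; apply: mmeasD => //.
  by have [[]] := gP (E r, Fs r) (mE r) IH.
pose D r := (g (E r, Fs r)).1; pose D' r := (g (E r, Fs r)).2.
have {}gP r := gP (E r, Fs r) (mE r) (mFs r).
have mD r : mmeas (D r) by have [[]] := gP r.
have mD' r : mmeas (D' r) by have [[]] := gP r.
have DE r : D r `<=` E r by have [_ []] := gP r.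
have D'F r : D' r `<=` Fs r by have [_ []] := gP r.
have DD' r : embeds (D r) (D' r) by have [] := gP r.
have D'D r : embeds (D' r) (D r) by have [] := gP r.
have FsS r s y : r < s -> Fs s y -> Fs r y /\ ~ D' r y.
  elim: s => // s IH; rewrite ltnS leq_eqVlt => /predU1P[->|rs] /= [? ?] //.
  exact: IH.
have FsF r : Fs r `<=` F by case: r => // r y /(FsS 0) -[].
have tD' : trivIset setT D'.
  move=> i j _ _ [y [yi yj]]; have [ij|ji|//] := ltngtP i j.
    by have [_] := FsS _ _ _ ij (D'F _ _ yj).
  by have [_] := FsS _ _ _ ji (D'F _ _ yi).
have tD : trivIset setT D.
  move=> i j _ _ [y [yi yj]]; apply: (tE i j I I); exists y.
  by split; exact: DE.
pose Q r := msat (E r `\` D r).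
have mQ r : measurable (Q r) by apply: measurable_msat; exact: mmeasD.
exists Q; split => //.
- by move=> r; exact: invariant_msat.
- apply: (embeds_bigcup_sub (E := D) (F := D')) => //.
  + apply: mmeas_over; first exact: mmeas_bigcup.
    by apply: measurableC; exact: bigcupT_measurable.
  + move=> [x i] [[r _ Er] nx]; exists r => //.
    apply: contrapT => Dx; apply: nx; exists r => //.
    exact: (@sub_msat _ _ _ _ _ i).
  + by move=> k y /D'F; exact: FsF.
(* Over [Q r] all of [F] was used in rounds 0 to [r], so the matchings of these rounds alone,
   reversed, carry [F] back into the first [r.+1] sets. *)
- move=> r; pose cut (K : nat -> set (X * nat)) k := if k <= r then K k else set0.
  have cutS K k : cut K k `<=` K k by rewrite /cut; case: ifP => // _ ?.
  apply: (embeds_bigcup_sub (E := cut D') (F := cut D)).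
  + exact: mmeas_over.
  + move=> [x j] [Fx [n [i [/= Ex Dx]]]]; apply: contrapT => nD'.
    have nD k : k <= r -> ~ D' k (x, j).
      by move=> kr D'x; apply: nD'; exists k => //; rewrite /cut kr.
    have Fsx s : s <= r -> Fs s (x, j).
      by elim: s => //= s IH sr; split; [exact/IH/ltnW|exact/nD/ltnW].
    apply: (nD r) => //; have [_ _ _ _ sep] := gP r.
    by have := sep _ _ (inv n) j Ex Dx; rewrite actV; apply; exact: Fsx.
  + move=> k y; rewrite /cut; case: ifP => // kr /DE Ey.
    by exists k => //=; rewrite ltnS.
  + move=> k; rewrite /cut; case: ifP => // _; apply: embeds_sub => // i.
    exact: measurable0.
  + move=> i j _ _ [y [/cutS yi /cutS yj]]; apply: (tD i j I I).
    by exists y.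
Qed.

Lemma embeds_restrictl S S' A n k : invariant S' -> measurable S' -> S' `<=` S ->
  embeds (blk S 0 k) (blk A 0 n) -> embeds (blk S' 0 k) (blk (A `&` S') 0 n).
Proof.
by move=> iS' mS' sS /(embeds_over iS' mS'); rewrite !over_blk (setIidr sS).
Qed.

Lemma embeds_restrictr S S' A n k : invariant S' -> measurable S' -> S' `<=` S ->
  embeds (blk (A `&` S) 0 n) (blk S 0 k) -> embeds (blk (A `&` S') 0 n) (blk S' 0 k).
Proof.
move=> iS' mS' sS /(embeds_over iS' mS').
by rewrite !over_blk -setIA (setIidr sS).
Qed.

(** The hypotheses bound the density of [A] on [S] below by [k / n] and above by the smaller
    [k' / n']. Clearing denominators, [n' * k] copies of [S] go into [n * n'] copies of [A] within
    [S], hence into only [n * k'] copies of [S]. *)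
Lemma null_of_embeds_lt S A n k n' k' : invariant S -> measurable S ->
  measurable A ->
  embeds (blk S 0 k) (blk A 0 n) -> embeds (blk (A `&` S) 0 n') (blk S 0 k') ->
  n * k' < n' * k -> null S.
Proof.
move=> iS mS mA /(embeds_restrictl iS mS (@subset_refl _ _)) l1 l2 lt.
have mAS : measurable (A `&` S) by exact: measurableI.
apply: (@null_of_shrink _ _ _ _ (n * k')) => //.
apply: (@embeds_subl _ _ _ (blk S 0 (n' * k))); first exact: mmeas_blk.
  exact: blk_sub.
apply: embeds_trans (embeds_scale n' mS mAS l1) _; rewrite mulnC.
exact: embeds_scale.
Qed.

(** The last clause normalises the choice at [k = 0], so that density at least 0 holds at every
    point and not merely off a null set. *)
Definition is_cut A n k (P : set X) :=
  [/\ invariant P, measurable P, embeds (blk P 0 k) (blk A 0 n),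
      embeds (blk (A `&` ~` P) 0 n) (blk (~` P) 0 k) & k = 0 -> P = setT].

(* [cut A n k] is, up to null sets, the set of points at which the fraction of
   [A] in the orbit is at least [k / n]. *)
Definition cut A n k : set X := xget set0 [set P | is_cut A n k P].

Lemma cutP A n k : measurable A -> is_cut A n k (cut A n k).
Proof.
move=> mA; rewrite /cut; case: xgetP => // nP; exfalso.
have [k0|kn] := eqVneq k 0.
  apply: (nP setT); rewrite k0; split => //.
    apply: embeds_sub; first exact: mmeas_blk.
    by move=> [x i] [].
  apply: embeds_sub; first by rewrite setCT setI0; exact: mmeas_blk.
  by move=> [x i] [[_ /= nx]]; case: nx.
have mT : mmeas (blk [set: X] 0 k) by exact: mmeas_blk.
have mn : mmeas (blk A 0 n) by exact: mmeas_blk.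
have [P [iP mP l1 l2]] := embeds_comparison mT mn.
apply: (nP P); split => //.
- by rewrite over_blk setTI in l1.
- have mCP : measurable (~` P) by exact: measurableC.
  have iCP := invariantC iP.
  have /(embeds_over iCP mCP) := l2; rewrite !over_blk setTI.
  by rewrite -setIA setIid.
- by move=> k0; rewrite k0 in kn.
Qed.

Lemma invariant_cut A n k : measurable A -> invariant (cut A n k).
Proof. by move=> /(cutP n k)[]. Qed.

Lemma measurable_cut A n k : measurable A -> measurable (cut A n k).
Proof. by move=> /(cutP n k)[]. Qed.

Lemma cut0 A n : measurable A -> cut A n 0 = setT.
Proof. by move=> /(cutP n 0)[_ _ _ _]; exact. Qed.

Lemma embeds_cut A n k S : measurable A -> invariant S -> measurable S ->
  S `<=` cut A n k -> embeds (blk S 0 k) (blk (A `&` S) 0 n).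
Proof. by move=> /(cutP n k)[_ _ l _ _] iS mS sS; exact: embeds_restrictl l. Qed.

Lemma embeds_cutC A n k S : measurable A -> invariant S -> measurable S ->
  S `<=` ~` cut A n k -> embeds (blk (A `&` S) 0 n) (blk S 0 k).
Proof. by move=> /(cutP n k)[_ _ _ l _] iS mS sS; exact: embeds_restrictr l. Qed.

Definition ae (Q : X -> Prop) := exists2 S, null S & forall x, ~ Q x -> S x.

Lemma null0 : null set0.
Proof.
split; [by []|exact: measurable0|].
by apply: embeds_sub => [i|[x i] //]; exact: measurable0.
Qed.

Lemma aeT (Q : X -> Prop) : (forall x, Q x) -> ae Q.
Proof. by move=> hQ; exists set0 => [|x]; [exact: null0|case]. Qed.

Lemma ae_forall (I : countType) (Q : I -> X -> Prop) :
  (forall i, ae (Q i)) -> ae (fun x => forall i, Q i x).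
Proof.
move=> aeQ; have /choice[S SP] : forall i, exists S,
    null S /\ forall x, ~ Q i x -> S x.
  by move=> i; have [S ? ?] := aeQ i; exists S.
pose T n := if unpickle n is Some i then S i else set0.
exists (\bigcup_n T n).
  apply: null_bigcup => n; rewrite /T; case: unpickle => [i|]; last exact: null0.
  by have [] := SP i.
move=> x nQ; apply: contrapT => nT; apply: nQ => i; apply: contrapT => nQ.
apply: nT; exists (pickle i) => //; rewrite /T pickleK.
by have [_] := SP i; exact.
Qed.

Lemma ae_and Q1 Q2 : ae Q1 -> ae Q2 -> ae (fun x => Q1 x /\ Q2 x).
Proof.
move=> ae1 ae2.
have [|S nS SP] := @ae_forall bool (fun b x => if b then Q1 x else Q2 x).
  by case.
exists S => // x nQ; apply: SP => hQ; apply: nQ.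
by split; [exact: (hQ true)|exact: (hQ false)].
Qed.

Lemma ae_inh Q : ~ null setT -> ae Q -> exists x, Q x.
Proof.
move=> nn [S nS SP]; apply: contrapT => nQ; apply: nn.
rewrite (_ : setT = S)//; apply/esym/seteqP; split => // x _.
by apply: SP => ?; apply: nQ; exists x.
Qed.

(** The inequality does not depend on the point: either it is true, or the exceptional points all
    lie in the null set [S]. *)
Lemma ae_leq (S : set X) (Q : X -> Prop) m n : (n < m -> null S) ->
  (forall x, Q x -> S x) -> ae (fun x => Q x -> m <= n).
Proof.
move=> nS QS; have [mn|nm] := leqP m n; first exact: aeT.
by exists S; [exact: nS|move=> x nQ; apply: QS; apply: contrapT => ?; exact: nQ].
Qed.

Section cut_ae.
Variables A B : set X.
Hypotheses (mA : measurable A) (mB : measurable B).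
Let mcut A n k := @measurable_cut A n k.
Let icut A n k := @invariant_cut A n k.
Let mcutC A n k mA := measurableC (@mcut A n k mA).
Let icutC A n k mA := invariantC (@icut A n k mA).

(** This and the next estimates follow one scheme: where two density bounds contradict each other,
    the points form an invariant set carrying both embeddings of [null_of_embeds_lt]. Leaving the
    factor [n] uncancelled in the later ones keeps [n = 0] trivially true. *)
Lemma ae_cut_mono n k n' k' :
  ae (fun x => cut A n k x /\ ~ cut A n' k' x -> n' * k <= n * k').
Proof.
pose S := cut A n k `&` ~` cut A n' k'.
have iS : invariant S by apply: invariantI; [exact: icut|exact: icutC].
have mS : measurable S by apply: measurableI; [exact: mcut|exact: mcutC].
apply: (@ae_leq S) => // lt.
apply: (null_of_embeds_lt iS mS mA (n := n) (k := k) (n' := n') (k' := k')) => //.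
  apply: (@embeds_subr _ _ _ _ (blk (A `&` S) 0 n)); first exact: blk_sub.
  by apply: embeds_cut => // x [].
by apply: embeds_cutC => // x [].
Qed.

Lemma ae_cut_setU_ge n k l q : A `&` B = set0 ->
  ae (fun x => (cut A n k x /\ cut B n l x) /\ ~ cut (A `|` B) n q x ->
    n * (k + l) <= n * q).
Proof.
move=> AB; pose S := (cut A n k `&` cut B n l) `&` ~` cut (A `|` B) n q.
have mAB : measurable (A `|` B) by exact: measurableU.
have iS : invariant S.
  apply: invariantI; last exact: icutC.
  by apply: invariantI; exact: icut.
have mS : measurable S.
  by apply: measurableI; [apply: measurableI; exact: mcut|exact: mcutC].
apply: (@ae_leq S) => // lt.
apply: (null_of_embeds_lt iS mS mAB (n := n) (k := k + l) (n' := n) (k' := q)) => //.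
  apply: embeds_addl => //.
    apply: (@embeds_subr _ _ _ _ (blk (A `&` S) 0 n)); first exact: blk_sub.
    by apply: embeds_cut => // x [[]].
  apply: (@embeds_subr _ _ _ _ (blk (B `&` S) 0 n)); first exact: blk_sub.
  by apply: embeds_cut => // x [[]].
by apply: embeds_cutC => // x [].
Qed.

Lemma ae_cut_setU_le n k l q :
  ae (fun x => (~ cut A n k x /\ ~ cut B n l x) /\ cut (A `|` B) n q x ->
    n * q <= n * (k + l)).
Proof.
pose S := (~` cut A n k `&` ~` cut B n l) `&` cut (A `|` B) n q.
have mAB : measurable (A `|` B) by exact: measurableU.
have iS : invariant S.
  apply: invariantI; last exact: icut.
  by apply: invariantI; exact: icutC.
have mS : measurable S.
  by apply: measurableI; [apply: measurableI; exact: mcutC|exact: mcut].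
apply: (@ae_leq S) => // lt.
apply: (null_of_embeds_lt iS mS mAB (n := n) (k := q) (n' := n) (k' := k + l)) => //.
  apply: (@embeds_subr _ _ _ _ (blk ((A `|` B) `&` S) 0 n)); first exact: blk_sub.
  by apply: embeds_cut => // x [].
rewrite setIUl; apply: embeds_addr => //; try exact: measurableI.
  by apply: embeds_cutC => // x [[]].
by apply: embeds_cutC => // x [[]].
Qed.

Lemma ae_cut_preimage a n k q :
  ae (fun x => cut (h a @^-1` A) n k x /\ ~ cut A n q x -> n * k <= n * q).
Proof.
pose A' := h a @^-1` A; pose S := cut A' n k `&` ~` cut A n q.
have mA' : measurable A' by exact: act_measurable.
have iS : invariant S by apply: invariantI; [exact: icut|exact: icutC].
have mS : measurable S by apply: measurableI; [exact: mcut|exact: mcutC].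
apply: (@ae_leq S) => // lt.
apply: (null_of_embeds_lt iS mS mA (n := n) (k := k) (n' := n) (k' := q)) => //.
  apply: (embeds_trans (F := blk A' 0 n)).
    apply: (@embeds_subr _ _ _ _ (blk (A' `&` S) 0 n)); first exact: blk_sub.
    by apply: embeds_cut => // x [].
  exists (fun y => (a, y.2)); split.
  - move=> i p; apply: measurable_and => /=; last exact: measurable_cstP.
    exact: mmeas_blk.
  - by move=> [x i].
  - move=> [x i] [x' i'] _ _ [e ->]; congr (_, _).
    by rewrite -(actV h a x) e actV.
by apply: embeds_cutC => // x [].
Qed.

Lemma ae_cut_le n k : ae (fun x => cut A n k x -> k <= n).
Proof.
have iS := @invariant_cut A n k mA; have mS := @measurable_cut A n k mA.
apply: (@ae_leq (cut A n k)) => // lt.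
apply: (null_of_embeds_lt iS mS mS (n := n) (k := k) (n' := 1) (k' := 1)) => //.
- apply: (@embeds_subr _ _ _ _ (blk (A `&` cut A n k) 0 n)); first exact: blk_sub.
  exact: embeds_cut.
- by apply: embeds_sub; [apply: mmeas_blk; exact: measurableI|exact: blk_sub].
- by rewrite muln1 mul1n.
Qed.

Lemma ae_cut_setT_ge n k : ae (fun x => ~ cut setT n k x -> n <= k).
Proof.
have mT : measurable [set: X] by [].
have iS := invariantC (@invariant_cut setT n k mT).
have mS := measurableC (@measurable_cut setT n k mT).
apply: (@ae_leq (~` cut setT n k)) => // lt.
apply: (null_of_embeds_lt iS mS mS (n := 1) (k := 1) (n' := n) (k' := k)) => //.
- by apply: embeds_sub; [exact: mmeas_blk|exact: blk_sub].
- by rewrite setIid -[X in blk X 0 n]setTI; apply: embeds_cutC.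
- by rewrite mul1n muln1.
Qed.

End cut_ae.

(* If the partial unions had density below [k / n], the union could be matched
   piece by piece into [k.+1] copies of the space. *)
Lemma ae_cut_bigcup (A : nat -> set X) n k : 0 < n ->
  (forall i, measurable (A i)) ->
  ae (fun x => cut (\bigcup_i A i) n k.+2 x ->
    exists r, cut (\big[setU/set0]_(i < r) A i) n k x).
Proof.
move=> n0 mA; have mU : measurable (\bigcup_i A i) by exact: bigcupT_measurable.
pose B r := \big[setU/set0]_(i < r) A i.
have mB r : measurable (B r) by exact: bigsetU_measurable.
pose T := cut (\bigcup_i A i) n k.+2 `&` \bigcap_r ~` cut (B r) n k.
exists T; last first.
  move=> x nx; split; first by apply: contrapT => ?; apply: nx.
  by move=> r _ cx; apply: nx => _; exists r.
have iT : invariant T.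
  apply: invariantI; first exact: invariant_cut.
  apply: invariant_bigcap => r; apply: invariantC; exact: invariant_cut.
have mT : measurable T.
  apply: measurableI; first exact: measurable_cut.
  apply: bigcapT_measurable => r; apply: measurableC; exact: measurable_cut.
pose E r := blk (seqDU A r `&` T) 0 n.
have mD r : measurable (seqDU A r) by exact: seqDU_measurable.
have mE r : mmeas (E r) by apply: mmeas_blk; exact: measurableI.
have tE : trivIset setT E.
  move=> i j _ _ [y [[[yi _] _] [[yj _] _]]].
  by apply: (@trivIset_seqDU _ A i j) => //; exists y.1.
(* The value [k.+1] leaves a gap of one on both sides: above [k], which makes each [Q r] null within
   [T], and below [k.+2], which makes the rest of [T] null. *)
have mF : mmeas (blk T 0 k.+1) by exact: mmeas_blk.
have [Q [iQ mQ l1 l2]] := embeds_sigma_comparison mE tE mF.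
have nQ r : null (Q r `&` T).
  have iS := invariantI (iQ r) iT; have mS := measurableI _ _ (mQ r) mT.
  apply: (null_of_embeds_lt iS mS (mB r.+1) (n := n) (k := k.+1) (n' := n) (k' := k)).
  - have := l2 r; rewrite over_blk setIC; apply: embeds_subr.
    move=> [x i] [j /= jr [[/= Ax Tx] xn]]; split => //=.
    rewrite /B -bigcup_mkord; exists j => //.
    exact: (@subset_seqDU _ A j).
  - by apply: embeds_cutC => // x [_ [_]]; exact.
  - by rewrite ltn_pmul2l.
have nR : null (T `&` ~` \bigcup_r Q r).
  have iS := invariantI iT (invariantC (invariant_bigcup (D := setT) iQ)).
  have mS : measurable (T `&` ~` \bigcup_r Q r).
    by apply: measurableI => //; apply: measurableC; exact: bigcupT_measurable.
  apply: (null_of_embeds_lt iS mS mU (n := n) (k := k.+2) (n' := n) (k' := k.+1)).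
  - apply: (@embeds_subr _ _ _ _ (blk (\bigcup_i A i `&` (T `&` ~` \bigcup_r Q r)) 0 n)).
      exact: blk_sub.
    by apply: embeds_cut => // x [[]].
  - have := embeds_over iS mS l1; rewrite over_blk (setIidr (@subIsetl _ _ _)).
    apply: embeds_subl; first by apply: mmeas_blk; exact: measurableI.
    move=> [x i] [[/= + [Tx nQx]] xn]; rewrite seqDU_bigcup_eq => -[r _ Ax].
    by split => //; split => //; exists r.
  - by rewrite ltn_pmul2l.
apply: null_sub (null_bigcup (S := fun r => if r is s.+1 then Q s `&` T else
   T `&` ~` \bigcup_r Q r) _) iT mT _; first by case.
move=> x Tx; have [[r _ Qx]|nx] := pselect ((\bigcup_r Q r) x).
  by exists r.+1.
by exists 0.
Qed.

End cuts.

(** * Contents and measures invariant under a countable group *)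

(** Discards the rounding errors of the integer cuts, which stay bounded while [n] grows. *)
Lemma natmul_bounded_le0 (R : realType) (x c : R) :
  (forall n : nat, (0 < n)%N -> n%:R * x <= c)%R -> (x <= 0)%R.
Proof.
move=> xc; rewrite leNgt; apply/negP => x0.
have := xc (Num.trunc (c / x)%R).+1 isT; rewrite leNgt => /negP; apply.
by rewrite -ltr_pdivrMr//; exact: truncnS_gt.
Qed.

Section point_content.
Context d (X : measurableType d) (h : countable_action X) (R : realType).
Local Notation null := (null h).
Local Notation ae := (ae h).
Local Notation cut := (cut h).

Lemma ae_forall_countable T (D : set T) (Q : T -> X -> Prop) : countable D ->
  (forall t, D t -> ae (Q t)) -> ae (fun x => forall t, D t -> Q t x).
Proof.
move=> /countable_injP[f f_inj] aeQ.
have [|S nS SP] :=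
    @ae_forall _ X h nat (fun n x => forall t, D t -> f t = n -> Q t x).
  move=> n; have [[t [Dt ft]]|nt] := pselect (exists t, D t /\ f t = n).
    have [S nS SP] := aeQ t Dt; exists S => // x nQ; apply: SP => Qt.
    by apply: nQ => s Ds fs; rewrite (f_inj s t) ?inE// fs.
  by apply: aeT => x t Dt ft; case: nt; exists t.
exists S => // x nQ; apply: SP => hQ; apply: nQ => t Dt; exact: hQ.
Qed.

Record set_algebra (A : set (set X)) : Prop := SetAlgebra {
  set_algebraT : A setT ;
  set_algebraU : forall B C, A B -> A C -> A (B `|` C) ;
  set_algebraC : forall B, A B -> A (~` B) ;
  set_algebra_pre : forall a B, A B -> A (h a @^-1` B) ;
  set_algebra_meas : A `<=` measurable
}.

Lemma set_algebra0 A : set_algebra A -> A set0.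
Proof. by move=> sA; rewrite -setCT; apply: set_algebraC; case: sA. Qed.

Lemma set_algebraI A B C : set_algebra A -> A B -> A C -> A (B `&` C).
Proof.
move=> sA AB AC; rewrite -[_ `&` _]setCK setCI.
by apply: (set_algebraC sA); apply: (set_algebraU sA); exact: (set_algebraC sA).
Qed.

Lemma set_algebraD A B C : set_algebra A -> A B -> A C -> A (B `\` C).
Proof.
by move=> sA AB AC; apply: set_algebraI => //; exact: (set_algebraC sA).
Qed.

Lemma set_algebra_bigU A (u : nat -> set X) n : set_algebra A ->
  (forall i, A (u i)) -> A (\big[setU/set0]_(i < n) u i).
Proof.
move=> sA Au; elim/big_ind : _ => //; first exact: set_algebra0.
exact: set_algebraU.
Qed.

(** The value [m B] is the density of [B] at one point [x]: the supremum of the fractions [k / n]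
    with [x] in [cut B n k]. Countability of [A] and [W] allows [x] to avoid all exceptional null
    sets at once. *)
Lemma content_exists (A : set (set X)) (W : set (nat -> set X)) :
  ~ null setT -> set_algebra A -> countable A -> countable W ->
  (forall u, W u -> (forall i, A (u i)) /\ A (\bigcup_i u i)) ->
  exists m : set X -> R,
  [/\ (forall B, A B -> 0 <= m B)%R, m setT = 1%R,
      (forall B C, A B -> A C -> B `&` C = set0 -> m (B `|` C) = m B + m C)%R,
      (forall a B, A B -> m (h a @^-1` B) = m B) &
      (forall u e, W u -> 0 < e -> exists r,
        m (\bigcup_i u i) <= m (\big[setU/set0]_(i < r) u i) + e)%R].
Proof.
move=> nT sA cA cW WA; have mA := set_algebra_meas sA.
have /(ae_inh nT)[x [[[[[[Hmono Hge] Hle] Hpre] Hbd] HT] HW]] :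
  ae (fun x => (((((
    (forall B, A B -> forall n k n' k',
      cut B n k x /\ ~ cut B n' k' x -> n' * k <= n * k') /\
    (forall B, A B -> forall C, A C -> forall n k l q, B `&` C = set0 ->
      (cut B n k x /\ cut C n l x) /\ ~ cut (B `|` C) n q x ->
      n * (k + l) <= n * q)) /\
    (forall B, A B -> forall C, A C -> forall n k l q,
      (~ cut B n k x /\ ~ cut C n l x) /\ cut (B `|` C) n q x ->
      n * q <= n * (k + l))) /\
    (forall B, A B -> forall a n k q,
      cut (h a @^-1` B) n k x /\ ~ cut B n q x -> n * k <= n * q)) /\
    (forall B, A B -> forall n k, cut B n k x -> k <= n)) /\
    (forall n k, ~ cut setT n k x -> n <= k)) /\
    (forall u, W u -> forall n k, cut (\bigcup_i u i) n.+1 k.+2 x ->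
      exists r, cut (\big[setU/set0]_(i < r) u i) n.+1 k x)).
  do ![apply: ae_and].
  - apply: ae_forall_countable => // B /mA mB.
    do 4! [apply: ae_forall => ?]; exact: ae_cut_mono.
  - apply: ae_forall_countable => // B /mA mB.
    apply: ae_forall_countable => // C /mA mC.
    apply: ae_forall => n; apply: ae_forall => k; apply: ae_forall => l.
    apply: ae_forall => q.
    have [e|ne] := pselect (B `&` C = set0); last by apply: aeT => ? /ne.
    have [S nS SP] := @ae_cut_setU_ge _ X h B C mB mC n k l q e.
    by exists S => // y ny; apply: SP => hy; apply: ny => _.
  - apply: ae_forall_countable => // B /mA mB.
    apply: ae_forall_countable => // C /mA mC.
    do 4! [apply: ae_forall => ?]; exact: ae_cut_setU_le.
  - apply: ae_forall_countable => // B /mA mB.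
    do 4! [apply: ae_forall => ?]; exact: ae_cut_preimage.
  - apply: ae_forall_countable => // B /mA mB.
    do 2! [apply: ae_forall => ?]; exact: ae_cut_le.
  - do 2! [apply: ae_forall => ?]; exact: ae_cut_setT_ge.
  - apply: ae_forall_countable => // u /WA[Au _].
    do 2! [apply: ae_forall => ?]; apply: ae_cut_bigcup => // i.
    exact: mA.
pose E B : set R := [set r | exists n k,
  [/\ 0 < n, cut B n k x & r = (k%:R / n%:R)%R]].
pose m B : R := sup (E B).
have m_ge B n k : A B -> 0 < n -> cut B n k x -> (k%:R <= n%:R * m B)%R.
  move=> AB n0 ck; rewrite mulrC -ler_pdivrMr ?ltr0n//; apply: ub_le_sup; last first.
    by exists n, k.
  exists 1%R => _ [n' [k' [n'0 /(Hbd _ AB) kn ->]]].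
  by rewrite ler_pdivrMr ?ltr0n// mul1r ler_nat.
have m_le B n k : A B -> 0 < n -> ~ cut B n k x -> (n%:R * m B <= k%:R)%R.
  move=> AB n0 ck; rewrite mulrC -ler_pdivlMr ?ltr0n//; apply: ge_sup.
    by exists (0%:R / 1%:R)%R; exists 1, 0; split => //; rewrite cut0//; exact: mA.
  move=> _ [n' [k' [n'0 ck' ->]]].
  have := Hmono _ AB _ _ _ _ (conj ck' ck).
  rewrite ler_pdivrMr ?ltr0n// mulrAC ler_pdivlMr ?ltr0n//.
  by rewrite -!natrM ler_nat mulnC [n' * k]mulnC.
(* The product of [n] and the density of [B] is thus bracketed between [k] and [k.+1]; the downward
   search from [n] stops at 0 at the latest. *)
have ck B n : A B -> exists k, cut B n k x /\ ~ cut B n k.+1 x.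
  move=> AB; have: ~ cut B n n.+1 x by move=> /(Hbd _ AB); rewrite ltnn.
  move: {2}n; elim=> [|k IH] nk.
    by exists 0; split => //; rewrite cut0//; exact: mA.
  by have [ck|/IH] := pselect (cut B n k.+1 x); first by exists k.+1.
have m0 B : A B -> (0 <= m B)%R.
  move=> AB; have := @m_ge B 1 0 AB isT; rewrite mul1r; apply.
  by rewrite cut0//; exact: mA.
have m_pre_le a B : A B -> (m (h a @^-1` B) <= m B)%R.
  move=> AB; have AB' := set_algebra_pre sA a AB.
  (* One unit is lost in the comparison of [k] with [q] and one in the upper bracket. For additivity
     below there are three brackets, whence the constant 3. *)
  rewrite -subr_le0; apply: (@natmul_bounded_le0 _ _ 2%:R) => n n0.
  have [k [k1 k2]] := ck _ n AB'; have [q [q1 q2]] := ck _ n AB.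
  have := Hpre _ AB _ _ _ _ (conj k1 q2); rewrite leq_pmul2l// => kq.
  have := m_le _ _ _ AB' n0 k2; have := m_ge _ _ _ AB n0 q1.
  have : (k%:R <= q%:R + 1 :> R)%R by rewrite natr1 ler_nat.
  rewrite mulrBr -natr1; lra.
exists m; split => //.
- apply/eqP; rewrite eq_le; have AT := set_algebraT sA.
  apply/andP; split; rewrite -subr_le0; apply: (@natmul_bounded_le0 _ _ 1%R) => n n0.
    have [k [k1 k2]] := ck _ n AT; have kn := Hbd _ AT _ _ k1.
    have := m_le _ _ _ AT n0 k2.
    have : (k%:R <= n%:R :> R)%R by rewrite ler_nat.
    rewrite mulrBr -natr1; lra.
  have [k [k1 k2]] := ck _ n AT; have kn := HT _ _ k2.
  have := m_ge _ _ _ AT n0 k1.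
  have : (n%:R <= k%:R + 1 :> R)%R by rewrite natr1 ler_nat.
  rewrite mulrBr; lra.
- move=> B C AB AC BC; have ABC := set_algebraU sA AB AC.
  apply/eqP; rewrite eq_le.
  apply/andP; split; rewrite -subr_le0; apply: (@natmul_bounded_le0 _ _ 3%R) => n n0.
    have [k [k1 k2]] := ck _ n AB; have [l [l1 l2]] := ck _ n AC.
    have [q [q1 q2]] := ck _ n ABC.
    have := Hle _ AB _ AC _ _ _ _ (conj (conj k2 l2) q1).
    rewrite leq_pmul2l//.
    have := m_ge _ _ _ AB n0 k1; have := m_ge _ _ _ AC n0 l1.
    have := m_le _ _ _ ABC n0 q2.
    rewrite mulrBr mulrDr -!natr1 => ? ? ?; rewrite -(ler_nat R).
    rewrite natrD -!natr1; lra.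
  have [k [k1 k2]] := ck _ n AB; have [l [l1 l2]] := ck _ n AC.
  have [q [q1 q2]] := ck _ n ABC.
  have := Hge _ AB _ AC _ _ _ _ BC (conj (conj k1 l1) q2).
  rewrite leq_pmul2l//.
  have := m_le _ _ _ AB n0 k2; have := m_le _ _ _ AC n0 l2.
  have := m_ge _ _ _ ABC n0 q1.
  rewrite mulrBr mulrDr -!natr1 => ? ? ?; rewrite -(ler_nat R).
  rewrite natrD -!natr1; lra.
- move=> a B AB; apply/eqP; rewrite eq_le m_pre_le//=.
  have := m_pre_le (act_inv h a) _ (set_algebra_pre sA a AB).
  rewrite (_ : _ @^-1` (_ @^-1` _) = B)//.
  by apply/seteqP; split => y; rewrite /preimage /= actVr.
- move=> u e Wu e0; have [Au AU] := WA u Wu.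
  have AB r : A (\big[setU/set0]_(i < r) u i) by exact: (set_algebra_bigU r sA Au).
  (* Passing to a partial union costs two units and the upper bracket one; divided by [n.+1], these
     three units are at most [e]. *)
  pose n := Num.trunc (3%:R / e)%R.
  have ne : (3%:R <= n.+1%:R * e)%R.
    by rewrite -ler_pdivrMr//; apply: ltW; exact: (truncnS_gt (3%:R / e)%R).
  (* Below two units nothing can be subtracted, but then the whole union has content at most [e] and
     the empty partial union suffices. *)
  have small k : k <= 1 -> ~ cut (\bigcup_i u i) n.+1 k.+1 x ->
      exists r, (m (\bigcup_i u i) <= m (\big[setU/set0]_(i < r) u i) + e)%R.
    move=> k1 k2; exists 0; rewrite -(ler_pM2l (ltr0Sn R n)) mulrDr.
    have := m_le _ _ _ AU (ltn0Sn n) k2; rewrite -[k.+1%:R%R]natr1.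
    have := mulr_ge0 (ler0n R n.+1) (m0 _ (AB 0%N)).
    by move: k1; rewrite -(ler_nat R); lra.
  have [[|[|k]] [k1 k2]] := ck _ n.+1 AU; [exact: (@small 0%N)|exact: (@small 1%N)|].
  have [r cr] := HW _ Wu _ _ k1; exists r.
  rewrite -(ler_pM2l (ltr0Sn R n)) mulrDr.
  have := m_ge _ _ _ (AB r) (ltn0Sn n) cr; have := m_le _ _ _ AU (ltn0Sn n) k2.
  rewrite -[k.+3%:R%R]natr1 -[k.+2%:R%R]natr1 -[k.+1%:R%R]natr1; lra.
Qed.

End point_content.

(** * From contents to measures by ultrafilters *)

Lemma countable_setU T (A B : set T) :
  countable A -> countable B -> countable (A `|` B).
Proof.
move=> cA cB; rewrite -bigcup2inE; apply: bigcup_countable => //.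
by move=> [|[|i]].
Qed.

(** Unary operations are passed as binary ones that ignore an argument. *)
Lemma countable_closure T (op : nat -> T -> T -> T) (G : set T) :
  countable G -> exists C, [/\ countable C, G `<=` C &
    forall n x y, C x -> C y -> C (op n x y)].
Proof.
move=> cG.
pose step (C : set T) := C `|`
  \bigcup_(n in setT) \bigcup_(x in C) [set op n x y | y in C].
pose Cs k := iter k step G.
have cCs k : countable (Cs k).
  elim: k => //= k IH; apply: countable_setU => //.
  apply: bigcup_countable => // n _; apply: bigcup_countable => // x _.
  exact: sub_countable (card_image_le _ _) IH.
have CsS i j : (i <= j)%N -> Cs i `<=` Cs j.
  move=> /subnK <-; elim: (j - i)%N => //= k IH x /IH; exact: subsetUl.
exists (\bigcup_k Cs k); split.
- by apply: bigcup_countable.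
- by move=> x Gx; exists 0%N.
- move=> n x y [i _ xi] [j _ yj]; exists (maxn i j).+1 => //.
  right; exists n => //; exists x; first exact: CsS (leq_maxl _ _) _ xi.
  by exists y => //; exact: CsS (leq_maxr _ _) _ yj.
Qed.

(** On the sequence [u] the family [F] behaves like the sets containing a fixed point. *)
Definition resolves T (F : set (set T)) (u : nat -> set T) :=
  F (\bigcup_i u i) -> exists i, F (u i).

Definition determines T (W : set (nat -> set T)) (A : set (set T)) :=
  forall F, UltraFilter F -> (forall u, W u -> resolves F u) ->
    exists x, forall B, A B -> F B <-> B x.

(* The trace of standardness needed here: countably many countable unions
   replace compactness. *)
Definition standard_space d (X : measurableType d) :=
  forall A : set (set X), countable A -> A `<=` measurable ->
  exists W : set (nat -> set X), [/\ countable W,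
    forall u i, W u -> measurable (u i) & determines W A].

Lemma ultra_bigU T (F : set (set T)) (u : nat -> set T) n : UltraFilter F ->
  F (\big[setU/set0]_(i < n) u i) -> exists i, F (u i).
Proof.
move=> FU; elim: n => [|n IH].
  by rewrite big_ord0 => /filter_not_empty.
rewrite big_ord_recr /= => FUu.
have [/IH//|Fn] := in_ultra_setVsetC (\big[setU/set0]_(i < n) u i) FU.
exists n; apply: filterS (filterI FUu Fn) => x [[ux nx|//]].
by case: (nx ux).
Qed.

Lemma ultra_of_uncovered T (Z : nat -> set T) :
  (forall i j, (i <= j)%N -> Z i `<=` Z j) -> (forall n, Z n <> setT) ->
  exists2 F : set (set T), UltraFilter F & forall n, F (~` Z n).
Proof.
move=> Zmono ZT.
have FF : ProperFilter (filter_from setT (fun n => ~` Z n)).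
  apply: filter_from_proper.
    apply: filter_from_filter; first by exists 0%N.
    move=> i j _ _; exists (maxn i j) => // x nx.
    by split=> ?; apply: nx; [apply: Zmono (leq_maxl _ _) _ _|
                              apply: Zmono (leq_maxr _ _) _ _].
  move=> n _; apply: contrapT => ne; apply: (ZT n); apply/seteqP; split => // x _.
  by apply: contrapT => nx; apply: ne; exists x.
have [F [FU sF]] := ultraFilterLemma FF.
by exists F => // n; apply: sF; exists n.
Qed.

Section nadkarni.
Context d (X : measurableType d) (h : countable_action X) (R : realType).

(** A copy of [X] on which the countable algebra [A] is the measurable structure, as the extension
    of a content requires. *)
Definition algebra_type A (sA : set_algebra h A) : Type := X.

Section algebra_instance.
Variables (A : set (set X)) (sA : set_algebra h A).

HB.instance Definition _ := Pointed.on (algebra_type sA).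
HB.instance Definition _ := @isAlgebraOfSets.Build d (algebra_type sA) A
  (set_algebra0 sA) (set_algebraU sA) (set_algebraC sA).

End algebra_instance.

Lemma set_algebra_gen (G : set (set X)) : countable G -> G `<=` measurable ->
  exists A, [/\ set_algebra h A, countable A & G `<=` A].
Proof.
move=> cG mG.
pose op n (B C : set X) : set X := match n with
  | 0 => (B `|` C) | 1 => (~` B) | k.+2 => (h k @^-1` B) end.
have cG' : countable (G `|` [set setT]).
  exact: countable_setU.
have [C [cC GC Cop]] := countable_closure op cG'.
have GC' B : G B -> C B by move=> GB; apply: GC; left.
(* The operations make sense for all sets and preserve measurability, so cutting down to measurable
   sets keeps the closure properties. *)
pose A := C `&` measurable.
have CT : C setT by apply: GC; right.
exists A; split; last by move=> B GB; split; [exact: GC'|exact: mG].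
- split.
  + by split.
  + move=> B D [CB mB] [CD mD]; split; last exact: measurableU.
    exact: (Cop 0%N).
  + by move=> B [CB mB]; split; [exact: (Cop 1%N B B)|exact: measurableC].
  + move=> a B [CB mB]; split; last exact: act_measurable.
    exact: (Cop a.+2 B B).
  + by move=> B [].
- by apply: sub_countable cC; apply: subset_card_le => B [].
Qed.

Section content.
Variables (A : set (set X)) (W : set (nat -> set X)) (m : set X -> R).
Hypothesis sA : set_algebra h A.
Hypothesis m0 : (forall B, A B -> 0 <= m B)%R.
Hypothesis mT : m setT = 1%R.
Hypothesis mU : (forall B C, A B -> A C -> B `&` C = set0 ->
  m (B `|` C) = m B + m C)%R.

Lemma content_set0 : m set0 = 0%R.
Proof.
have A0 := set_algebra0 sA; have := mU A0 A0 (setI0 _); rewrite setU0; lra.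
Qed.

Lemma content_le B C : A B -> A C -> B `<=` C -> (m B <= m C)%R.
Proof.
move=> AB AC BC; rewrite -[C](setDUK BC) mU.
- rewrite lerDl; apply: m0; exact: (set_algebraD sA).
- by [].
- exact: (set_algebraD sA).
- exact: setDIK.
Qed.

Lemma content_leU B C : A B -> A C -> (m (B `|` C) <= m B + m C)%R.
Proof.
move=> AB AC; have AD := set_algebraD sA AC AB.
rewrite (_ : B `|` C = B `|` (C `\` B)); last first.
  apply/seteqP; split => x [?|]; try by left.
    by have [?|?] := pselect (B x); [left|right].
  by move=> [? _]; right.
rewrite mU//; last exact: setDIK.
by rewrite lerD2l; apply: content_le => // x [].
Qed.

Lemma content_le_sum (u : nat -> set X) n : (forall i, A (u i)) ->
  (m (\big[setU/set0]_(i < n) u i) <= \sum_(i < n) m (u i))%R.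
Proof.
move=> Au; elim: n => [|n IH]; first by rewrite !big_ord0 content_set0.
rewrite !big_ord_recr /=; apply: le_trans (content_leU _ _) _ => //.
  exact: (set_algebra_bigU n sA Au).
by rewrite lerD2r.
Qed.

Lemma content_sum (u : nat -> set X) n : (forall i, A (u i)) ->
  trivIset setT u ->
  (m (\big[setU/set0]_(i < n) u i) = \sum_(i < n) m (u i))%R.
Proof.
move=> Au tu; elim: n => [|n IH]; first by rewrite !big_ord0 content_set0.
rewrite !big_ord_recr /= mU ?IH//; first exact: (set_algebra_bigU n sA Au).
apply/seteqP; split => // x; rewrite -bigcup_mkord => -[[i /= iN ui] un].
have /(_ _ _ I I)e := tu; have : i = n by apply: e; exists x.
by move=> ein; rewrite ein ltnn in iN.
Qed.

Hypothesis cW : countable W.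
Hypothesis AW : forall u, W u -> (forall i, A (u i)) /\ A (\bigcup_i u i).
Hypothesis mW : (forall u e, W u -> 0 < e -> exists r,
  m (\bigcup_i u i) <= m (\big[setU/set0]_(i < r) u i) + e)%R.
Variable A1 : set (set X).
Hypothesis A1A : A1 `<=` A.
Hypothesis WA1 : determines W A1.

(** A cover of content below 1 would leave room for an ultrafilter that avoids it together with
    small tails of the unions from [W]. Such an ultrafilter resolves [W], so on [A1] it is given by
    a point, and that point is not covered. *)
Lemma content_cover_ge1 (c : nat -> set X) (s : R) : (forall i, A1 (c i)) ->
  \bigcup_i c i = setT -> (forall n, \sum_(i < n) m (c i) <= s)%R -> (1 <= s)%R.
Proof.
move=> A1c cT cs; rewrite leNgt; apply/negP => s1.
have Ac i : A (c i) by exact: A1A.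
(* Half of the missing content is spent on the tails [D n], with a share [e / 2 ^ n.+1] for the
   sequence of number [n]; [s + e] is still below 1. *)
pose e := ((1 - s) / 2)%R; have e0 : (0 < e)%R by rewrite /e; lra.
have [f f_inj] := countable_injP _ cW.
have half0 n : (0 < e * 2^-1 ^+ n.+1 :> R)%R.
  by rewrite mulr_gt0// exprn_gt0// invr_gt0.
have /choice[D DP] : forall n, exists D, [/\ A D, (m D <= e * 2^-1 ^+ n.+1)%R &
    forall u, W u -> f u = n -> exists r,
      (\bigcup_i u i) `\` (\big[setU/set0]_(i < r) u i) `<=` D].
  move=> n; have [[u [Wu fu]]|nu] := pselect (exists u, W u /\ f u = n); last first.
    exists set0; split; [exact: (set_algebra0 sA)|by rewrite content_set0 ltW|].
    by move=> u Wu fu; case: nu; exists u.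
  have [Au AU] := AW Wu; have [r mr] := mW Wu (half0 n).
  have Ar := set_algebra_bigU r sA Au.
  exists ((\bigcup_i u i) `\` \big[setU/set0]_(i < r) u i); split.
  - exact: (set_algebraD sA).
  - have sub : \big[setU/set0]_(i < r) u i `<=` \bigcup_i u i.
      by rewrite -bigcup_mkord => x [i _ ?]; exists i.
    rewrite -{1}(setDUK sub) mU ?setDIK// in mr; last exact: (set_algebraD sA).
    by move: mr; rewrite lerD2l.
  - move=> v Wv fv; exists r; rewrite (f_inj v u) ?inE//; last by rewrite fv.
have AD n : A (D n) by have [] := DP n.
pose Z n := \big[setU/set0]_(i < n) c i `|` \big[setU/set0]_(i < n) D i.
have ZT n : Z n <> setT.
  move=> ZT; have : (m (Z n) <= s + e)%R.
    apply: le_trans (content_leU _ _) _; try exact: (set_algebra_bigU n sA).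
    apply: lerD; first exact: le_trans (content_le_sum _ _) (cs _).
    apply: le_trans (content_le_sum _ _) _ => //.
    apply: (@le_trans _ _ (e * (1 - 2^-1 ^+ n))%R); last first.
      by rewrite ger_pMr// gerBl exprn_ge0// invr_ge0.
    elim: {ZT} n => [|n IH]; first by rewrite big_ord0 expr0 subrr mulr0.
    rewrite big_ord_recr /=; have [_ Dn _] := DP n.
    apply: le_trans (lerD IH Dn) _; rewrite exprS; lra.
  by rewrite ZT mT /e; lra.
have Zmono i j : (i <= j)%N -> Z i `<=` Z j.
  move=> ij x; rewrite /Z -!bigcup_mkord => -[[k /= ki ?]|[k /= ki ?]].
    by left; exists k => //=; exact: leq_trans ij.
  by right; exists k => //=; exact: leq_trans ij.
have [F FU FZ] := ultra_of_uncovered Zmono ZT.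
have Fc i : F (~` c i).
  apply: filterS (FZ i.+1) => x nx cx; apply: nx; left.
  by rewrite big_ord_recr /=; right.
have [u Wu FUu|x xP] := WA1 FU.
  have [_ _ /(_ u Wu erefl)[r sub]] := DP (f u).
  apply: (@ultra_bigU _ _ _ r) => //.
  apply: filterS (filterI FUu (FZ (f u).+1)) => x [ux nx].
  apply: contrapT => nr; apply: nx; right.
  by rewrite big_ord_recr /=; right; exact: sub.
have : (\bigcup_i c i) x by rewrite cT.
move=> [i _ cx]; have /(xP _ (A1c i)) Fci := cx.
apply: (@filter_not_empty _ F _); rewrite -(setICr (c i)).
exact: filterI.
Qed.

End content.

Theorem nadkarni (G : set (set X)) : ~ null h setT -> standard_space X ->
  countable G -> G `<=` measurable -> measurable `<=` <<s G >> ->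
  exists mu : probability X R,
    forall a B, measurable B -> mu (h a @^-1` B) = mu B.
Proof.
move=> nT std cG mG measG.
have [A1 [sA1 cA1 GA1]] := set_algebra_gen cG mG.
have [W [cW measW WA1]] := std A1 cA1 (set_algebra_meas sA1).
(* The sequences [W] are chosen for [A1], but their terms and unions need a content too. So the
   content lives on a larger algebra [A], while only its restriction to [A1] is extended. *)
pose G2 : set (set X) := A1 `|` \bigcup_(u in W) ([set \bigcup_i u i] `|` range u).
have cG2 : countable G2.
  apply: countable_setU => //; apply: bigcup_countable => // u _.
  apply: countable_setU => //.
  by apply: sub_countable (card_image_le _ _) _.
have mG2 : G2 `<=` measurable.
  move=> B [/(set_algebra_meas sA1)//|[u Wu [->|[i _ <-]]]]; last exact: measW.
  by apply: bigcupT_measurable => i; exact: measW.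
have [A [sA cA GA]] := set_algebra_gen cG2 mG2.
have AW u : W u -> (forall i, A (u i)) /\ A (\bigcup_i u i).
  move=> Wu; split=> [i|]; apply: GA; right; exists u => //; last by left.
  by right; exists i.
have A1A : A1 `<=` A by move=> B AB; apply: GA; left.
have [m [m0 mT mU mh mW]] := content_exists R nT sA cA cW AW.
(* The absolute value gives nonnegativity on all sets, as a content must have; on the algebra it
   changes nothing. *)
pose f (B : set (algebra_type sA1)) : \bar R := (`|m B|%:E)%E.
have fE B : A1 B -> f B = (m B)%:E.
  by move=> AB; rewrite /f ger0_norm// m0//; exact: A1A.
have f0 B : (0 <= f B)%E by rewrite lee_fin.
have f_add : measure_function.semi_additive f.
  move=> F n mF tF mUF; rewrite fE// (content_sum sA mU)//; last first.
    by move=> i; apply: A1A; exact: mF.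
  by rewrite -sumEFin; apply: eq_bigr => i _; rewrite fE//; exact: mF.
(* If subadditivity failed for [B], its complement followed by the [F n] would cover the space with
   total content below 1. *)
have f_sub : measurable_subset_sigma_subadditive f.
  move=> B F mF mB BF; rewrite leNgt; apply/negP => lt.
  pose S := (\sum_(n <oo) f (F n))%E.
  have Sfin : S \is a fin_num.
    rewrite ge0_fin_numE; last exact: nneseries_ge0.
    by apply: lt_trans lt _; rewrite ltry.
  pose c i := if i is j.+1 then F j else ~` B.
  have A1c i : A1 (c i) by case: i => [|i]; [exact: (set_algebraC sA1)|exact: mF].
  have cT : \bigcup_i c i = setT.
    apply/seteqP; split => // x _; have [/BF[i _ ?]|?] := pselect (B x).
      by exists i.+1.
    by exists 0%N.
  have mCB : (m (~` B) = 1 - m B)%R.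
    rewrite -mT -(setUv B) mU ?setICr//; [lra|exact: A1A|].
    exact: A1A (A1c 0%N).
  have : (1 <= 1 - m B + fine S)%R.
    apply: (content_cover_ge1 sA m0 mT mU cW AW mW A1A WA1 A1c cT) => -[|n].
      rewrite big_ord0 addr_ge0//; last by rewrite fine_ge0// nneseries_ge0.
      by rewrite -mCB m0//; exact: A1A (A1c 0%N).
    rewrite big_ord_recl /= mCB lerD2l -lee_fin fineK// -sumEFin.
    apply: le_trans (nneseries_lim_ge n _) => //.
    by rewrite big_mkord; apply: lee_sum => i _; rewrite fE//; exact: mF.
  move: lt; rewrite fE// -/S -(fineK Sfin) lte_fin; lra.
pose f_content : content (algebra_type sA1) R :=
  HB.pack f (@isContent.Build _ _ _ f f0 f_add).
pose mu : measure (algebra_type sA1) R := HB.pack (Content.sort f_content)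
  (Content_SigmaSubAdditive_isMeasure.Build _ _ _ (Content.sort f_content) f_sub).
have muE B : A1 B -> mu_ext mu B = (m B)%:E.
  by move=> AB; rewrite measurable_mu_extE//; exact: fE.
have measA1 B : measurable B -> <<s A1 >> B.
  by move=> /measG; apply: sub_smallest2r.
have P_add : semi_sigma_additive (mu_ext mu : set X -> \bar R).
  move=> F mF tF mUF.
  apply: (@measure_semi_sigma_additive _ _ _ (measure_extension mu) F) => //.
    by move=> i; exact: measA1.
  exact: measA1.
have P0 : mu_ext mu set0 = 0%E.
  by rewrite muE ?(content_set0 sA mU)//; exact: (set_algebra0 sA1).
have P_ge0 B : (0 <= mu_ext mu B)%E by exact: mu_ext_ge0.
have PT : mu_ext mu setT = 1%E by rewrite muE ?mT//; exact: (set_algebraT sA1).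
pose P_measure : measure X R := HB.pack (mu_ext mu : set X -> \bar R)
  (isMeasure.Build d X R (mu_ext mu : set X -> \bar R) P0 P_ge0 P_add).
pose P : probability X R := HB.pack (Measure.sort P_measure)
  (Measure_isProbability.Build d X R (Measure.sort P_measure) PT).
(* The outer measure inherits invariance because [A1] is stable under the action: covers translate
   to covers with the same contents. *)
have P_le a B : (mu_ext mu (h a @^-1` B) <= mu_ext mu B)%E.
  apply: ereal_inf_le_tmp => _ [c [Ac Bc] <-].
  have Ac' i : A1 (h a @^-1` c i) by apply: (set_algebra_pre sA1); exact: Ac.
  exists (fun i => h a @^-1` c i).
    by split => // x /Bc[i _ ?]; exists i.
  apply: eq_eseriesr => i _; rewrite /= !fE//; last exact: Ac.
  by rewrite mh//; apply: A1A; exact: Ac.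
exists P => a B mB; apply/eqP; rewrite eq_le P_le/=.
have := P_le (act_inv h a) (h a @^-1` B).
rewrite (_ : _ @^-1` (_ @^-1` _) = B)//.
by apply/seteqP; split => y; rewrite /preimage /= actVr.
Qed.

End nadkarni.

(** * Polish spaces *)

Lemma countable_enum T (D : set T) : countable D -> D !=set0 ->
  exists e : nat -> T, D = range e.
Proof.
move=> /countable_injP[f f_inj] [t0 Dt0].
have /choice[e eP] : forall n, exists t, D t /\ forall s, D s -> f s = n -> s = t.
  move=> n; have [[t [Dt ft]]|nt] := pselect (exists t, D t /\ f t = n).
    by exists t; split => // s Ds fs; apply: f_inj; rewrite ?inE// fs.
  by exists t0; split => // s Ds fs; case: nt; exists s.
exists e; apply/seteqP; split => [t Dt|_ [n _ <-]]; last by case: (eP n).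
by exists (f t) => //; have [_ /(_ _ Dt erefl)] := eP (f t).
Qed.

Definition radius (R : realType) (n : nat) : R := (n.+1%:R^-1)%R.

Lemma radius_gt0 (R : realType) n : (0 < radius R n)%R.
Proof. by rewrite invr_gt0. Qed.

Lemma radius_small (R : realType) (r : R) :
  (0 < r)%R -> exists n, (radius R n < r)%R.
Proof.
move=> r0; exists (Num.trunc r^-1%R); rewrite /radius invf_plt ?posrE//.
exact: truncnS_gt.
Qed.

Section metric.
Context (R : realType) (T : topologicalType) (d : T -> T -> R).
Local Notation rad := (radius R).
Hypothesis md : is_metric d.
Hypothesis dT : metric_induces d.
Let dxx x : d x x = 0%R. Proof. by case: md => _ dE _ _; apply/dE. Qed.
Let dC : forall x y, d x y = d y x. Proof. by case: md. Qed.
Let dD : forall x y z, (d x z <= d x y + d y z)%R. Proof. by case: md. Qed.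

Definition mball x r : set T := [set y | (d x y < r)%R].

Lemma mball_open x r : open (mball x r).
Proof.
apply/dT => y; rewrite /mball /= => dxy; exists (r - d x y)%R.
  by rewrite subr_gt0.
by move=> z /= dyz; have := dD x y z; lra.
Qed.

Lemma mball_center x r : (0 < r)%R -> mball x r x.
Proof. by move=> r0; rewrite /mball /= dxx. Qed.

Lemma open_mball (U : set T) x : open U -> U x ->
  exists2 r, (0 < r)%R & mball x r `<=` U.
Proof. by move=> /dT + Ux; apply. Qed.

Lemma dense_mball (S : set T) x r : dense S -> (0 < r)%R ->
  exists2 q, S q & mball x r q.
Proof.
move=> dS r0; have [|q [? ?]] := dS _ _ (mball_open x r); last by exists q.
by exists x; exact: mball_center.
Qed.

Lemma mball_sub q x r s : mball q r x -> (r + r <= s)%R -> mball q r `<=` mball x s.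
Proof.
by rewrite /mball /= => qx rs y /= qy; have := dD x q y; rewrite (dC x q); lra.
Qed.

Lemma countable_basis (S : set T) : countable S -> dense S ->
  exists B : set (set T), [/\ countable B, B `<=` open &
    forall U x, open U -> U x -> exists V, [/\ B V, V x & V `<=` U]].
Proof.
move=> cS dS.
exists (\bigcup_(q in S) range (fun n => mball q (rad n))); split.
- apply: bigcup_countable => // q _.
  by apply: sub_countable (card_image_le _ _) _.
- by move=> _ [q _ [n _ <-]]; exact: mball_open.
- move=> U x oU Ux; have [r r0 rU] := open_mball oU Ux.
  have [|n nr] := @radius_small R (r / 2)%R; first by rewrite divr_gt0.
  have n0 : (0 < rad n)%R by exact: radius_gt0.
  have [q Sq xq] := dense_mball x dS n0.
  have qx : mball q (rad n) x by rewrite /mball /= dC.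
  exists (mball q (rad n)); split => //; first by exists q => //; exists n.
  apply: subset_trans rU; apply: (mball_sub (q := q)) => //.
  by rewrite [leRHS]splitr ltW// ltrD.
Qed.

Hypothesis complete : forall u, metric_cauchy d u -> exists l : T, u @ \oo --> l.

Definition converges (F : set (set T)) x := forall U, open U -> U x -> F U.

(** Any two balls belonging to [F] meet, so their centres form a Cauchy sequence. *)
Lemma ultra_cauchy_converges F : UltraFilter F ->
  (forall n, exists q, F (mball q (rad n))) -> exists x, converges F x.
Proof.
move=> FU /choice[q Fq].
have qq m n : (d (q m) (q n) < rad m + rad n)%R.
  have [y [ym yn]] := filter_ex (filterI (Fq m) (Fq n)).
  by have := dD (q m) y (q n); rewrite (dC y); move: ym yn; rewrite /mball /=; lra.
have inv_le N m : (N <= m)%N -> (rad m <= rad N)%R.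
  by move=> Nm; rewrite /radius lef_pV2 ?posrE// ler_nat.
have [|x qx] := complete (u := q).
  move=> e e0; have [|N Ne] := @radius_small R (e / 2)%R; first by rewrite divr_gt0.
  exists N => m n Nm Nn; have := qq m n; have := inv_le _ _ Nm.
  by have := inv_le _ _ Nn; lra.
exists x => U oU Ux; have [r r0 rU] := open_mball oU Ux.
have [|N Nr] := @radius_small R (r / 2)%R; first by rewrite divr_gt0.
have r20 : (0 < r / 2)%R by rewrite divr_gt0.
have /qx[M _ MP] : nbhs x (mball x (r / 2)%R).
  by apply: open_nbhs_nbhs; split; [exact: mball_open|exact: mball_center].
have := MP (maxn M N) (leq_maxl _ _); rewrite /mball /= => xq.
apply: filterS (Fq (maxn M N)) => y; rewrite /mball /= => qy; apply: rU.
have := inv_le _ _ (leq_maxr M N); have := dD x (q (maxn M N)) y.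
rewrite /mball /=; lra.
Qed.

Definition meager (M : set T) := exists C : nat -> set T,
  [/\ forall n, closed (C n), forall n U, open U -> U !=set0 -> ~ (U `<=` C n)
    & M `<=` \bigcup_n C n].

Lemma baire (U M : set T) : open U -> U !=set0 -> meager M ->
  exists x, U x /\ ~ M x.
Proof.
move=> oU [x0 Ux0] [C [cC eC MC]].
(* The closed ball of [q] must lie in the open ball of [p], since the limit of the centres is known
   to belong to the closed balls only. *)
pose good n (p q : T * R) := (0 < q.2)%R /\ (q.2 <= rad n)%R /\
  forall y, (d q.1 y <= q.2)%R -> mball p.1 p.2 y /\ ~ C n y.
have [r0 r00 r0U] := open_mball oU Ux0.
have /choice[f fP] : forall np : nat * (T * R), exists q,
    (0 < np.2.2)%R -> good np.1 np.2 q.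
  move=> [n [x r]] /=; have [r_gt0|?] := pselect (0 < r)%R; last by exists (x, r).
  have [y [xy nCy]] : exists y, mball x r y /\ ~ C n y.
    apply: contrapT => ny; apply: (eC n _ (mball_open x r)).
      by exists x; exact: mball_center.
    by move=> y xy; apply: contrapT => ?; apply: ny; exists y.
  have oV : open (mball x r `&` ~` C n).
    by apply: openI; [exact: mball_open|exact: closed_openC].
  have [s s0 sV] := open_mball oV (conj xy nCy).
  pose t := (Num.min (s / 2) (rad n))%R.
  have t0 : (0 < t)%R by rewrite lt_min divr_gt0//= radius_gt0.
  exists (y, t) => _; split => //; split; first by rewrite ge_min lexx orbT.
  move=> z /= yz; apply: sV; rewrite /mball /=.
  have : (t <= s / 2)%R by rewrite ge_min lexx.
  lra.
pose p := fix p n := if n is m.+1 then f (m, p m) else (x0, r0).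
have p0 n : (0 < (p n).2)%R.
  by elim: n => [|n IH]; [exact: r00|have [] := fP (n, p n) IH].
have pP n : good n (p n) (p n.+1) := fP (n, p n) (p0 n).
have pball n m y : (n <= m)%N -> mball (p m).1 (p m).2 y -> mball (p n).1 (p n).2 y.
  move=> /subnK <-; elim: (m - n)%N => //= k IH yk; apply: IH.
  by have [_ [_ /(_ y)[]]] := pP (k + n)%N; rewrite // ltW.
have pd n m : (n <= m)%N -> (d (p n).1 (p m).1 < (p n).2)%R.
  by move=> nm; apply: (pball n m) => //; exact: mball_center.
have [|l pl] := complete (u := fun n => (p n).1).
  move=> e e0; have [|N Ne] := @radius_small R (e / 2)%R; first by rewrite divr_gt0.
  exists N.+1 => m n Nm Nn; have [_ [pN _]] := pP N.
  have := pd _ _ Nm; have := pd _ _ Nn.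
  by have := dD (p m).1 (p N.+1).1 (p n).1; rewrite (dC (p m).1 (p N.+1).1); lra.
have lP n : (d (p n).1 l <= (p n).2)%R.
  apply/ler_addgt0Pr => e e0.
  have /pl[K _ KP] : nbhs l (mball l e).
    by apply: open_nbhs_nbhs; split; [exact: mball_open|exact: mball_center].
  have := KP (maxn K n) (leq_maxl _ _); rewrite /mball /= => lp.
  have := pd _ _ (leq_maxr K n); have := dD (p n).1 (p (maxn K n)).1 l.
  by rewrite (dC (p (maxn K n)).1 l); lra.
have lC n : mball (p n).1 (p n).2 l /\ ~ C n l.
  by have [_ [_]] := pP n; apply; exact: lP.
exists l; split; first by apply: r0U; have [] := lC 0%N.
by move=> /MC[n _]; have [_] := lC n.
Qed.

End metric.

Lemma polish_basis (R : realType) (T : topologicalType) : polish R T ->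
  exists B : set (set T), [/\ countable B, B `<=` open &
    forall U x, open U -> U x -> exists V, [/\ B V, V x & V `<=` U]].
Proof. by move=> [[S cS dS] [d [md dT _]]]; exact: (countable_basis md dT cS dS). Qed.

Lemma polish_baire (R : realType) (T : topologicalType) (U M : set T) :
  polish R T -> open U -> U !=set0 -> meager M -> exists x, U x /\ ~ M x.
Proof. by move=> [_ [d [md dT cT]]]; exact: (baire md dT cT). Qed.

(** * Borel sets and the standardness of Polish spaces *)

Section borel.
Context (T : topologicalType).

Lemma borel0 : borel (@set0 T). Proof. exact: sigma_algebra0. Qed.

Lemma borelC (A : set T) : borel A -> borel (~` A).
Proof. by move=> bA; rewrite -setTD; exact: sigma_algebraCD. Qed.

Lemma borel_bigcup (A : nat -> set T) : (forall n, borel (A n)) ->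
  borel (\bigcup_n A n).
Proof. exact: sigma_algebra_bigcup. Qed.

Lemma borelU (A B : set T) : borel A -> borel B -> borel (A `|` B).
Proof.
move=> bA bB; rewrite -bigcup2E; apply: borel_bigcup => -[|[|n]] //=.
exact: borel0.
Qed.

Lemma borelI (A B : set T) : borel A -> borel B -> borel (A `&` B).
Proof.
by move=> bA bB; rewrite -[A `&` B]setCK setCI; apply: borelC; apply: borelU;
  exact: borelC.
Qed.

Lemma borelD (A B : set T) : borel A -> borel B -> borel (A `\` B).
Proof. by move=> bA bB; apply: borelI => //; exact: borelC. Qed.

Lemma borel_bigsetU (A : nat -> set T) n : (forall i, borel (A i)) ->
  borel (\big[setU/set0]_(i < n) A i).
Proof.
move=> bA; elim/big_ind : _ => //; first exact: borel0.
exact: borelU.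
Qed.

Lemma borel_open (A : set T) : open A -> borel A.
Proof. by move=> oA; apply: sub_sigma_algebra. Qed.

Lemma borel_ind (P : set T -> Prop) :
  P set0 -> (forall A, P A -> P (~` A)) ->
  (forall A : nat -> set T, (forall n, P (A n)) -> P (\bigcup_n A n)) ->
  (forall A, open A -> P A) -> forall A, borel A -> P A.
Proof.
move=> P0 PC PU PO A; apply: (smallest_sub (X := P)) => //.
by split => // B PB; rewrite setTD; exact: PC.
Qed.

End borel.

Section polish_standard.
Context (R : realType) (T : topologicalType).
Local Notation rad := (radius R).

(** The sequences [w n] of small balls make the ultrafilter converge, by completeness. Borel
    induction then attaches to each Borel set countably many further sequences that make membership
    in the ultrafilter agree with membership of the limit. *)
Lemma polish_standard (x0 : T) : polish R T -> standard_space (borelType x0).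
Proof.
move=> polT; have [[S cS dS] [d [md dT cT]]] := polT => A cA mA.
have [B [cB oB basisB]] := polish_basis polT.
have [q Sq] : exists q : nat -> T, S = range q.
  apply: countable_enum => //; have [|x [_ Sx]] := dS _ _ (@openT T).
    by exists x0.
  by exists x.
pose w n i : set T := mball d (q i) (rad n).
have w_cover n : \bigcup_i w n i = setT.
  apply/seteqP; split => // x _.
  have n0 : (0 < rad n)%R by exact: radius_gt0.
  have [y Sy xy] := dense_mball md dT x dS n0.
  have [_ _ dC _] := md.
  by move: Sy; rewrite Sq => -[i _ iy]; exists i => //; rewrite /w /mball /= iy dC.
pose dec (D : set T) (W : set (nat -> set T)) :=
  [/\ countable W, forall u i, W u -> borel (u i) &
   forall F x, UltraFilter F -> converges F x -> (forall u, W u -> resolves F u) ->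
     F D <-> D x].
have [d_ge0 dE dC dD] := md.
have decP D : borel D -> borel D /\ exists W, dec D W.
  move: D; apply: borel_ind.
  - split; first exact: borel0.
    exists set0; split => //.
    by move=> F x FU Fx _; split => // /filter_not_empty.
  - move=> D [bD [W [cW bW WD]]]; split; first exact: borelC.
    exists W; split => // F x FU Fx FW.
    have e := WD F x FU Fx FW; split.
      move=> FnD /e FD; apply: (@filter_not_empty _ F _).
      by rewrite -(setICr D); exact: filterI.
    by move=> nDx; have [/e|//] := in_ultra_setVsetC D FU.
  - move=> D DP; have bD n : borel (D n) by have [] := DP n.
    split; first exact: borel_bigcup.
    have /choice[W WP] : forall n, exists W, dec (D n) W by move=> n; case: (DP n).
    (* The sequence [D] itself is added: resolving it is what takes membership of the union to
       membership of one term. *)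
    exists ([set D] `|` \bigcup_n W n); split.
    + apply: countable_setU; first exact: countable1.
      by apply: bigcup_countable => // n _; have [] := WP n.
    + by move=> u i [->//|[n _ Wu]]; have [_ + _] := WP n; exact.
    + move=> F x FU Fx FW; split.
        move=> /(FW D (or_introl erefl))[i FDi]; exists i => //.
        have [_ _ e] := WP i; apply/(e F x) => // u Wu.
        by apply: FW; right; exists i.
      move=> [i _ Dx]; apply: (@filterS _ F _ (D i)) => [y ?|]; first by exists i.
      have [_ _ e] := WP i; apply/(e F x) => // u Wu.
      by apply: FW; right; exists i.
  - move=> U oU; split; first exact: borel_open.
    (* Convergence gives one direction only. For the other, [U] is a union of balls whose doubles
       stay in [U]: once such a ball belongs to the ultrafilter, the limit lies in its double. *)
    pose v (k : nat) : set T := [set y | exists n i : nat,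
      [/\ k = pickle (n, i), w n i y &
          mball d (q i) (rad n + rad n)%R `<=` U]].
    have vU : \bigcup_k v k = U.
      apply/seteqP; split => y.
        move=> [k _ [n [i [_ wy]]]]; apply; move: wy; rewrite /w /mball /=.
        have : (0 < rad n)%R by exact: radius_gt0.
        lra.
      move=> Uy; have [r r0 rU] := open_mball dT oU Uy.
      have [|n nr] := @radius_small R (r / 3%:R)%R; first by rewrite divr_gt0.
      have : (\bigcup_i w n i) y by rewrite w_cover.
      move=> [i _ wy]; exists (pickle (n, i)) => //; exists n, i; split => //.
      apply: subset_trans rU => z; move: wy; rewrite /w /mball /= dC.
      by have := dD y (q i) z; lra.
    exists [set v]; split; first exact: countable1.
      move=> _ k ->; apply: borel_open.
      have [[[n i] [kE sU]]|nk] := pselect (exists p : nat * nat, k = pickle p /\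
          mball d (q p.2) (rad p.1 + rad p.1)%R `<=` U).
        rewrite (_ : v k = w n i); first exact: mball_open.
        apply/seteqP; split => y; last by move=> wy; exists n, i.
        by move=> [n' [i' [kE' + _]]]; move: kE'; rewrite kE => /(pcan_inj pickleK)[-> ->].
      rewrite (_ : v k = set0); first exact: open0.
      apply/seteqP; split => // y [n [i [kE _ sU]]]; apply: nk.
      by exists (n, i).
    move=> F x FU Fx FW; split; last exact: Fx.
    rewrite -vU => /(FW v erefl)[k Fv].
    have [_ [n [i [kE _ sU]]]] := filter_ex Fv; rewrite vU; apply: sU.
    have Fw : F (w n i).
      apply: filterS Fv => y [n' [i' [kE' wy _]]].
      by move: kE' wy; rewrite kE => /(pcan_inj pickleK)[-> ->].
    have n0 : (0 < rad n)%R by exact: radius_gt0.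
    have Fb : F (mball d x (rad n)).
      by apply: Fx; [exact: mball_open|exact: mball_center].
    have [y [iy xy]] := filter_ex (filterI Fw Fb).
    by have := dD (q i) y x; rewrite (dC y x); move: iy xy; rewrite /w /mball /=; lra.
have mA' D : A D -> borel D by move=> /mA.
have /choice[W WP] : forall D, exists W, A D -> dec D W.
  move=> D; have [/mA' /decP[_ [W ?]]|nA] := pselect (A D); last by exists set0 => /nA.
  by exists W.
exists (range w `|` \bigcup_(D in A) W D); split.
- apply: countable_setU; first exact: sub_countable (card_image_le _ _) _.
  by apply: bigcup_countable => // D /WP[].
- move=> u i [[n _ <-]|[D AD Wu]]; first by apply: borel_open; exact: mball_open.
  by have [_ + _] := WP D AD; exact.
- move=> F FU FW.
  have [|x Fx] := ultra_cauchy_converges md dT cT FU.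
    move=> n; have FT : F (\bigcup_i w n i) by rewrite w_cover; exact: filterT.
    have [|i Fi] := FW (w n) _ FT; first by left; exists n.
    by exists (q i).
  exists x => D AD; have [_ _ e] := WP D AD; apply: e => // u Wu.
  by apply: FW; right; exists D.
Qed.

End polish_standard.

(** * Vaught transforms *)

Lemma polish_separates (R : realType) (T : topologicalType) (x y : T) :
  polish R T -> (forall U, open U -> U x -> U y) -> x = y.
Proof.
move=> [_ [d [md dT _]]] xy; have [d_ge0 dE _ _] := md; apply/dE/eqP.
rewrite eq_le d_ge0 andbT leNgt; apply/negP => dxy.
have := xy _ (mball_open md dT x (d x y)) (mball_center md x dxy).
by rewrite /mball /= ltxx.
Qed.

Lemma bigcup_countable_nat I T (D : set I) (F : I -> set T) : countable D ->
  exists u : nat -> set T, \bigcup_(i in D) F i = \bigcup_n u n /\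
    forall n, u n = set0 \/ exists2 i, D i & u n = F i.
Proof.
move=> /countable_injP[f f_inj].
exists (fun n => [set x | exists i, [/\ D i, f i = n & F i x]]); split.
  apply/seteqP; split => x; first by move=> [i Di Fx]; exists (f i) => //; exists i.
  by move=> [n _ [i [Di _ Fx]]]; exists i.
move=> n; have [[i [Di fi]]|ni] := pselect (exists i, D i /\ f i = n).
  right; exists i => //; apply/seteqP; split => x; last by exists i.
  by move=> [j [Dj fj Fx]]; rewrite (f_inj i j) ?inE// fj.
left; apply/seteqP; split => // x [i [Di fi _]]; apply: ni; by exists i.
Qed.

Lemma borel_bigcup_countable I (T : topologicalType) (D : set I) (F : I -> set T) :
  countable D -> (forall i, D i -> borel (F i)) -> borel (\bigcup_(i in D) F i).
Proof.
move=> cD bF; have [u [-> uP]] := bigcup_countable_nat F cD.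
by apply: borel_bigcup => n; case: (uP n) => [->|[i Di ->]]; [exact: borel0|exact: bF].
Qed.

Lemma open_prod_nbhs (T U : topologicalType) (O : set (T * U)) x y :
  open O -> O (x, y) -> exists V W,
    [/\ open V, open W, V x, W y & forall a b, V a -> W b -> O (a, b)].
Proof.
move=> oO Oxy; have : nbhs (x, y) O by apply: open_nbhs_nbhs.
move=> [[V W] [/= Vx Wy] VW].
move: Vx Wy; rewrite !nbhsE => -[V' [oV' V'x] V'V] [W' [oW' W'y] W'W].
exists V', W'; split => // a b Va Wb; apply: (VW (a, b)).
by split; [exact: V'V|exact: W'W].
Qed.

Lemma open_section_l (T U : topologicalType) (O : set (T * U)) y :
  open O -> open [set x | O (x, y)].
Proof.
move=> oO; rewrite openE => x /= Oxy.
have [V [W [oV oW Vx Wy VW]]] := open_prod_nbhs oO Oxy.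
by rewrite /interior nbhsE; exists V => // z Vz; exact: VW.
Qed.

Lemma open_section_r (T U : topologicalType) (O : set (T * U)) x :
  open O -> open [set y | O (x, y)].
Proof.
move=> oO; rewrite openE => y /= Oxy.
have [V [W [oV oW Vx Wy VW]]] := open_prod_nbhs oO Oxy.
by rewrite /interior nbhsE; exists W => // z Wz; exact: VW.
Qed.

Lemma borel_section_r (T U : topologicalType) (O : set (T * U)) x :
  borel O -> borel [set y | O (x, y)].
Proof.
move: O; apply: borel_ind => [|A|A|A].
- exact: borel0.
- exact: borelC.
- move=> bA; rewrite (_ : mkset _ = \bigcup_n [set y | A n (x, y)]).
    exact: borel_bigcup.
  by apply/seteqP; split => y [n]; exists n.
- by move=> oA; apply: borel_open; exact: open_section_r.
Qed.

Section meager.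
Context (G : topologicalType).
Implicit Types M N : set G.

Lemma meager_sub M N : meager N -> M `<=` N -> meager M.
Proof. by move=> [C [? ? NC]] MN; exists C; split => //; exact: subset_trans NC. Qed.

Lemma meager_bigcup I (D : set I) (F : I -> set G) : countable D ->
  (forall i, D i -> meager (F i)) -> meager (\bigcup_(i in D) F i).
Proof.
move=> cD mF; have [u [-> uP]] := bigcup_countable_nat F cD.
have /choice[C CP] : forall n, exists C : nat -> set G, [/\ forall k, closed (C k),
    forall k U, open U -> U !=set0 -> ~ (U `<=` C k) & u n `<=` \bigcup_k C k].
  move=> n; case: (uP n) => [->|[i Di ->]]; last exact: mF.
  exists (fun=> set0); split => // [k|k U _ [x Ux] U0]; first exact: closed0.
  by have := U0 x Ux.
pose K j := if unpickle j is Some (n, k) then C n k else set0.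
exists K; split.
- move=> j; rewrite /K; case: unpickle => [[n k]|]; last exact: closed0.
  by have [] := CP n.
- move=> j U oU U0; rewrite /K; case: unpickle => [[n k]|].
    by have [_ + _] := CP n; exact.
  by move=> UU; have [x /UU] := U0.
- move=> x [n _ ux]; have [_ _ /(_ x ux)[k _ Cx]] := CP n.
  by exists (pickle (n, k)) => //; rewrite /K pickleK.
Qed.

Lemma meagerU M N : meager M -> meager N -> meager (M `|` N).
Proof.
move=> mM mN; rewrite -bigcup2inE; apply: meager_bigcup => //.
by move=> [|[|]].
Qed.

Lemma meager0 : meager (@set0 G).
Proof. by rewrite -(bigcup_set0 (fun _ : nat => set0)); exact: meager_bigcup. Qed.

Lemma meager_closed M : closed M ->
  (forall U, open U -> U !=set0 -> ~ (U `<=` M)) -> meager M.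
Proof. by move=> cM eM; exists (fun=> M); split => // x; exists 0%N. Qed.

Lemma meager_preimage (f g : G -> G) M : (forall U, open U -> open (f @^-1` U)) ->
  (forall U, open U -> open (g @^-1` U)) -> cancel f g -> cancel g f ->
  meager M -> meager (f @^-1` M).
Proof.
move=> cf cg fg gf [C [cC eC MC]]; exists (fun n => f @^-1` C n); split.
- by move=> n; rewrite -openC; apply: (cf (~` C n)); exact: closed_openC.
- move=> n U oU [x Ux] UC; apply: (eC n (g @^-1` U)); first exact: cg.
    by exists (f x); rewrite /preimage /= fg.
  by move=> y /UC; rewrite /preimage /= gf.
- by move=> x /MC [n _ ?]; exists n.
Qed.

Definition baire_property (E : set G) := exists O, [/\ open O, meager (E `\` O) &
  meager (O `\` E)].

Lemma baire_property_open O : open O -> baire_property O.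
Proof. by move=> oO; exists O; split => //; rewrite setDv; exact: meager0. Qed.

(** The boundary of an open set is closed with empty interior, so passing to the exterior changes
    the approximation by a meager set. *)
Lemma baire_propertyC E : baire_property E -> baire_property (~` E).
Proof.
move=> [ O [oO EO OE]]; exists (~` closure O); split.
- by apply: closed_openC; exact: closed_closure.
- have mB : meager (closure O `\` O).
    apply: meager_closed.
      by apply: closedI; [exact: closed_closure|exact: open_closedC].
    move=> U oU [x Ux] UB; have [clO nO] := UB x Ux.
    have [|y [Oy Uy]] := clO U; first exact: open_nbhs_nbhs.
    by have [_] := UB y Uy; apply.
  apply: meager_sub (meagerU OE mB) _ => x [nE /contrapT clO].
  by have [?|?] := pselect (O x); [left|right].
- apply: meager_sub EO _ => x [ncl /contrapT Ex]; split => // Ox.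
  by apply: ncl; exact: subset_closure.
Qed.

Lemma baire_property_bigcup (E : nat -> set G) :
  (forall n, baire_property (E n)) -> baire_property (\bigcup_n E n).
Proof.
move=> /choice[ O OP]; exists (\bigcup_n O n); split.
- by apply: bigcup_open => n _; have [] := OP n.
- apply: (@meager_sub _ (\bigcup_n (E n `\` O n))).
    by apply: meager_bigcup => // n _; have [] := OP n.
  by move=> x [[n _ Ex] nO]; exists n => //; split => // Ox; apply: nO; exists n.
- apply: (@meager_sub _ (\bigcup_n (O n `\` E n))).
    by apply: meager_bigcup => // n _; have [] := OP n.
  by move=> x [[n _ Ox] nE]; exists n => //; split => // Ex; apply: nE; exists n.
Qed.

Lemma baire_propertyD E F : baire_property E -> baire_property F ->
  baire_property (E `\` F).
Proof.
move=> bE bF; rewrite -[_ `\` _]setCK; apply: baire_propertyC.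
rewrite setCD -bigcup2E; apply: baire_property_bigcup => -[|[|n]] //=.
  exact: baire_propertyC.
by apply: baire_property_open; exact: open0.
Qed.

End meager.

Section vaught.
Context (R : realType) (G X : topologicalType).
Hypothesis polG : polish R G.
Hypothesis polX : polish R X.

(** Defined for all subsets of the product, not just those given by an action, so that induction
    over its Borel sets applies. *)
Definition vaught (E : set (G * X)) (U : set G) : set X :=
  [set x | ~ meager (U `&` [set g | E (g, x)])].

Lemma nonmeager_open (U : set G) : open U -> U !=set0 -> ~ meager U.
Proof. by move=> oU U0 /(polish_baire polG oU U0)[x []]. Qed.

(* A nonmeager set with the Baire property is comeager in some nonempty open
   set. *)
Lemma vaught_setC E (B : set (set G)) U x : B `<=` open ->
  (forall U x, open U -> U x -> exists V, [/\ B V, V x & V `<=` U]) ->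
  baire_property [set g | E (g, x)] -> open U ->
  vaught (~` E) U x <->
  exists V, (B V /\ V !=set0 /\ V `<=` U) /\ meager (V `&` [set g | E (g, x)]).
Proof.
move=> oB basisB bE oU; split.
  have [ O [oO EO OE]] := baire_propertyC bE => nm.
  have [g [Ug Og]] : U `&` O !=set0.
    apply: contrapT => UO; apply: nm; apply: meager_sub EO _ => g [Ug nE].
    by split => // Og; apply: UO; exists g.
  have [V [BV Vg VUO]] := basisB _ g (openI oU oO) (conj Ug Og).
  exists V; split; first by split => //; split; [exists g|move=> y /VUO[]].
  by apply: meager_sub OE _ => y [/VUO[_ Oy] Ey]; split => //; exact.
move=> [V [[BV [V0 VU]] mV]] mUE; apply: (nonmeager_open (oB _ BV) V0).
apply: meager_sub (meagerU mV mUE) _ => g Vg.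
by have [?|?] := pselect (E (g, x)); [left|right; split => //; exact: VU].
Qed.

(** The Baire property of the sections is carried along for the complement case, where localisation
    to basic open sets makes nonmeagerness a countable union of meagerness conditions. *)
Lemma borel_vaught E : borel E -> (forall x, baire_property [set g | E (g, x)]) /\
  forall U, open U -> borel (vaught E U).
Proof.
have [BG [cBG oBG basisG]] := polish_basis polG.
have [BX [cBX oBX basisX]] := polish_basis polX.
move: E; apply: borel_ind.
- split=> [x|U oU]; first by apply: baire_property_open; exact: open0.
  rewrite (_ : vaught _ _ = set0); first exact: borel0.
  apply/seteqP; split => // x; apply.
  by apply: meager_sub (@meager0 G) _ => g [].
- move=> E [bE mE]; split=> [x|U oU]; first exact: (baire_propertyC (bE x)).
  rewrite (_ : vaught _ _ = \bigcup_(V in [set V | BG V /\ V !=set0 /\ V `<=` U])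
    ~` vaught E V).
    apply: borel_bigcup_countable.
      by apply: sub_countable cBG; apply: subset_card_le => V [].
    by move=> V [BV _]; apply: borelC; apply: mE; exact: oBG.
  apply/seteqP; split => x.
    move=> /(vaught_setC oBG basisG (bE x) oU)[V [VP mV]]; by exists V.
  move=> [V VP /contrapT mV]; apply/(vaught_setC oBG basisG (bE x) oU).
  by exists V.
- move=> E EP; split=> [x|U oU].
    rewrite (_ : mkset _ = \bigcup_n [set g | E n (g, x)]).
      by apply: baire_property_bigcup => n; have [] := EP n.
    by apply/seteqP; split => g [n]; exists n.
  rewrite (_ : vaught _ _ = \bigcup_n vaught (E n) U).
    by apply: borel_bigcup => n; have [_] := EP n; exact.
  apply/seteqP; split => x.
    move=> nm; apply: contrapT => nV; apply: nm.
    apply: (@meager_sub _ _ (\bigcup_n (U `&` [set g | E n (g, x)]))).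
      apply: meager_bigcup => // n _; apply: contrapT => nm.
      by apply: nV; exists n.
    by move=> g [Ug [n _ Eg]]; exists n.
  move=> [n _ nm] m; apply: nm; apply: meager_sub m _ => g [Ug Eg].
  by split => //; exists n.
- move=> O oO; split=> [x|U oU].
    by apply: baire_property_open; exact: open_section_l.
  rewrite (_ : vaught _ _ = \bigcup_(V in [set V | BG V /\ ~ meager (U `&` V)])
    \bigcup_(W in [set W | BX W /\ V `*` W `<=` O]) W).
    apply: borel_bigcup_countable => [|V _].
      by apply: sub_countable cBG; apply: subset_card_le => V [].
    apply: borel_bigcup_countable => [|W [BW _]]; last exact: borel_open (oBX _ BW).
    by apply: sub_countable cBX; apply: subset_card_le => W [].
  apply/seteqP; split => x.
    move=> nm; apply: contrapT => nV; apply: nm.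
    apply: (@meager_sub _ _ (\bigcup_(V in [set V | BG V /\ meager (U `&` V)])
      (U `&` V))).
      apply: meager_bigcup => [|V []//].
      by apply: sub_countable cBG; apply: subset_card_le => V [].
    move=> g [Ug Og]; have [V [W [oV oW Vg Wx VW]]] := open_prod_nbhs oO Og.
    have [V' [BV' V'g V'V]] := basisG _ _ oV Vg.
    have [W' [BW' W'x W'W]] := basisX _ _ oW Wx.
    exists V' => //; split => //; apply: contrapT => nm; apply: nV.
    exists V' => //; exists W' => //; split => //.
    by move=> [a b] [/= V'a W'b]; apply: VW; [exact: V'V|exact: W'W].
  move=> [V [BV nm] [W [BW VW] Wx]] m; apply: nm; apply: meager_sub m _.
  by move=> g [Ug Vg]; split => //; apply: (VW (g, x)).
Qed.

Lemma vaught_bigcup E (U : nat -> set G) :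
  vaught E (\bigcup_n U n) = \bigcup_n vaught E (U n).
Proof.
apply/seteqP; split => x.
  move=> nm; apply: contrapT => nV; apply: nm.
  rewrite setI_bigcupl; apply: meager_bigcup => // n _.
  by apply: contrapT => nm; apply: nV; exists n.
by move=> [n _ nm] m; apply: nm; apply: meager_sub m _ => g [Ug Eg]; split => //; exists n.
Qed.

End vaught.

(** * From a dense subgroup to the whole group *)

Section topological_group.
Context (G : topologicalGroupType).

Lemma open_mulg (U : set G) : open U -> open [set p : G * G | U (p.1 * p.2)%g].
Proof. by move: U; apply/continuousP; exact: mulg_continuous. Qed.

Lemma open_mulgr (U : set G) k : open U -> open [set g | U (g * k)%g].
Proof. by move=> /open_mulg /open_section_l; exact. Qed.

Lemma open_mulgl (U : set G) k : open U -> open [set g | U (k * g)%g].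
Proof. by move=> /open_mulg /open_section_r; exact. Qed.

Lemma open_invg (U : set G) : open U -> open [set g | U (g^-1)%g].
Proof. by move: U; apply/continuousP; exact: invg_continuous. Qed.

Lemma open_divg_nbhs (U : set G) u : open U -> U u -> exists V W : set G,
  [/\ open V, open W, V u, W 1%g & forall g k, V g -> W k -> U (g * k^-1)%g].
Proof.
move=> oU Uu; have [|V [W [oV oW Vu W1 VW]]] :=
    @open_prod_nbhs _ _ _ u 1%g (open_mulg oU); first by rewrite /= mulg1.
exists V, [set k | W (k^-1)%g]; split => //.
- exact: open_invg.
- by rewrite /= invg1.
- by move=> g k Vg Wk; exact: (VW g (k^-1)%g).
Qed.

Lemma meager_mulgr (M : set G) k : meager M -> meager [set g | M (g * k)%g].
Proof.
move=> mM; apply: (@meager_preimage _ (fun g => g * k)%g (fun g => g * k^-1)%g) => //.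
- by move=> U; exact: open_mulgr.
- by move=> U; exact: open_mulgr.
- by move=> g; rewrite mulgK.
- by move=> g; rewrite mulgVK.
Qed.

End topological_group.

Section action.
Context (R : realType) (G : topologicalGroupType) (X : topologicalType)
  (act : G -> X -> X).
Hypothesis polG : polish R G.
Hypothesis polX : polish R X.
Hypothesis actB : borel_action act.

Let act1 x : act 1%g x = x. Proof. by case: actB => -[]. Qed.
Let actM g k x : act (g * k)%g x = act g (act k x).
Proof. by case: actB => -[]. Qed.
Let actV g x : act (g^-1)%g (act g x) = x.
Proof. by rewrite -actM mulVg act1. Qed.
Let actVr g x : act g (act (g^-1)%g x) = x.
Proof. by rewrite -actM mulgV act1. Qed.

Definition act_graph (A : set X) : set (G * X) := [set p | A (act p.1 p.2)].

Lemma borel_act_graph A : borel A -> borel (act_graph A).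
Proof. by case: actB => _; exact. Qed.

Lemma borel_act g A : borel A -> borel (act g @^-1` A).
Proof. by move=> /borel_act_graph /borel_section_r; exact. Qed.

Lemma act_image g A : act g @` A = act (g^-1)%g @^-1` A.
Proof.
apply/seteqP; split => [_ [x Ax <-]|x Ax]; first by rewrite /preimage /= actV.
by exists (act (g^-1)%g x).
Qed.

Definition vact (A : set X) (U : set G) : set X := vaught (act_graph A) U.

Lemma borel_vact A U : borel A -> open U -> borel (vact A U).
Proof.
by move=> /borel_act_graph /(borel_vaught polG polX)[_ bV] oU; exact: bV.
Qed.

(** Right translation by the inverse of [k] is a homeomorphism that sends the [g] in [V] with
    [act g x] in [A] to elements of [U] that take [act k x] into [A]. *)
Lemma vact_translate A U V k x : (forall g, V g -> U (g * k^-1)%g) ->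
  vact A V x -> vact A U (act k x).
Proof.
move=> VU nm m; apply: nm.
apply: meager_sub (meager_mulgr (k^-1)%g m) _ => g [Vg Ag]; split; first exact: VU.
by rewrite /act_graph /= actM actV.
Qed.

(** Equal transforms mean that for comeagerly many [g] the points [act g x] and [act g y] lie in the
    same basic open sets. By Baire category such a [g] exists. *)
Lemma vact_separates (BG : set (set G)) (BX : set (set X)) x y :
  countable BX -> BG `<=` open -> BX `<=` open ->
  (forall U x, open U -> U x -> exists V, [/\ BG V, V x & V `<=` U]) ->
  (forall U x, open U -> U x -> exists V, [/\ BX V, V x & V `<=` U]) ->
  (forall A U, BX A -> BG U -> vact A U x <-> vact A U y) -> x = y.
Proof.
move=> cBX oBG oBX basisG basisX xy.
(* A nonmeager difference would be comeager in some basic [U], and the transform over that [U] would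
   contain [z] but not [z']. *)
have meager_diff A z z' : BX A ->
    (forall U, BG U -> vact A U z -> vact A U z') ->
    meager ([set g | A (act g z)] `\` [set g | A (act g z')]).
  move=> BA zz'; have [bA _] :=
    borel_vaught polG polX (borel_act_graph (borel_open (oBX _ BA))).
  have [Q [oQ AQ QA]] := baire_propertyD (bA z) (bA z').
  have [[g Qg]|Q0] := pselect (Q !=set0); last first.
    apply: meager_sub AQ _ => g Ag; split => // Qg; apply: Q0; by exists g.
  have [U [BU Ug UQ]] := basisG _ _ oQ Qg; exfalso.
  have U0 : U !=set0 by exists g.
  have nU := nonmeager_open polG (oBG _ BU) U0.
  have nz' : ~ vact A U z'.
    apply; apply: meager_sub QA _ => k [Uk Ak]; split; first exact: UQ.
    by move=> [_]; apply.
  apply: nz'; apply: zz' => // mz; apply: nU.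
  apply: meager_sub (meagerU mz QA) _ => k Uk.
  have [Ak|nAk] := pselect (A (act k z)); [by left|right].
  by split; [exact: UQ|case].
pose D A := ([set g | A (act g x)] `\` [set g | A (act g y)]) `|`
  ([set g | A (act g y)] `\` [set g | A (act g x)]).
have mD : meager (\bigcup_(A in BX) D A).
  apply: meager_bigcup => // A BA.
  by apply: meagerU; apply: meager_diff => // U BU /(xy _ _ BA BU).
have [|g [_ nD]] := polish_baire polG (@openT G) _ mD; first by exists 1%g.
suff e : act g x = act g y by rewrite -(actV g x) e actV.
apply: polish_separates polX _ => U oU Ux.
have [A [BA Ax AU]] := basisX _ _ oU Ux; apply: AU; apply: contrapT => Ay.
by apply: nD; exists A => //; left.
Qed.

(* Exhaustion from inside that is stable under small translations. *)
Definition tame (P : set X) := exists Q : nat -> set X,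
  [/\ forall n, borel (Q n), forall i j, (i <= j)%N -> Q i `<=` Q j,
      P = \bigcup_n Q n &
      forall n, exists N : set G, [/\ open N, N 1%g &
        forall k x, N k -> Q n x -> P (act k x)]].

Lemma tame_borel P : tame P -> borel P.
Proof. by move=> [Q [bQ _ -> _]]; exact: borel_bigcup. Qed.

Lemma gen_tame_borel P : <<s tame >> P -> borel P.
Proof.
apply: smallest_sub; last exact: tame_borel.
split; [exact: borel0|by move=> C bC; rewrite setTD; exact: borelC|].
exact: borel_bigcup.
Qed.

(** [U] is exhausted by open sets that stay in [U] under a small right translation, and the
    transforms over these exhaust the transform over [U]. *)
Lemma tame_vact A U : borel A -> open U -> tame (vact A U).
Proof.
move=> bA oU; have [BG [cBG oBG basisG]] := polish_basis polG.
pose good V := exists2 W : set G, open W /\ W 1%g &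
  forall g k, V g -> W k -> U (g * k^-1)%g.
have [u [uE uP]] := @bigcup_countable_nat _ _ (BG `&` good) id
  (sub_countable (subset_card_le (@subIsetl _ _ _)) cBG).
have UE : U = \bigcup_n u n.
  rewrite -uE; apply/seteqP; split => g.
    move=> Ug; have [V [W [oV oW Vg W1 VW]]] := open_divg_nbhs oU Ug.
    have [V' [BV' V'g V'V]] := basisG _ _ oV Vg.
    exists V' => //; split => //; exists W => // a k V'a Wk.
    by apply: VW => //; exact: V'V.
  by move=> [V [_ [W [_ W1] VW]] Vg]; have := VW g 1%g Vg W1; rewrite invg1 mulg1.
have ou n : open (u n).
  by case: (uP n) => [->|[V [BV _] ->]]; [exact: open0|exact: oBG].
have gu n : good (u n).
  case: (uP n) => [->|[V [_ ?] ->]] //; exists setT => //.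
  by split => //; exact: openT.
(* Finite unions make the exhaustion increasing and still admit a common neighbourhood, the
   intersection of finitely many. *)
pose v n := \bigcup_(i in `I_n) u i.
have ov n : open (v n) by apply: bigcup_open => i _.
have gv n : good (v n).
  elim: n => [|n [W [oW W1] VW]].
    by exists setT => [|g k [i]] //; split => //; exact: openT.
  have [W' [oW' W'1] VW'] := gu n; exists (W `&` W').
    by split; [exact: openI|].
  move=> g k [i /= +] ug [Wk W'k]; rewrite ltnS leq_eqVlt => /predU1P[e|lt].
    by apply: VW' => //; rewrite -e.
  by apply: VW => //; exists i.
have vE : U = \bigcup_n v n.
  rewrite UE; apply/seteqP; split => g; last by move=> [n _ [i _ ?]]; exists i.
  by move=> [n _ ?]; exists n.+1 => //; exists n => /=.
exists (fun n => vact A (v n)); split.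
- by move=> n; exact: borel_vact.
- move=> i j ij x nm m; apply: nm; apply: meager_sub m _ => g [[l /= li ul] ?].
  by split => //; exists l => //=; exact: leq_trans ij.
- by rewrite [in LHS]vE /vact vaught_bigcup.
- move=> n; have [W [oW W1] VW] := gv n; exists W; split => // k x Wk.
  by apply: vact_translate => g vg; exact: VW.
Qed.

Lemma tameI P P' : tame P -> tame P' -> tame (P `&` P').
Proof.
move=> [Q [bQ mQ PE PN]] [Q' [bQ' mQ' PE' PN']].
exists (fun n => Q n `&` Q' n); split.
- by move=> n; exact: borelI.
- by move=> i j ij x [? ?]; split; [exact: (mQ i j)|exact: (mQ' i j)].
- rewrite PE PE'; apply/seteqP; split => x.
    move=> [[i _ Qi] [j _ Qj]]; exists (maxn i j) => //.
    by split; [exact: mQ (leq_maxl _ _) _ Qi|exact: mQ' (leq_maxr _ _) _ Qj].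
  by move=> [n _ [? ?]]; split; exists n.
- move=> n; have [N [oN N1 NP]] := PN n; have [N' [oN' N'1 NP']] := PN' n.
  exists (N `&` N'); split => //; first exact: openI.
  by move=> k x [Nk N'k] [Qx Q'x]; split; [exact: NP|exact: NP'].
Qed.

Lemma tame_translate P a : tame P -> tame (act a @^-1` P).
Proof.
move=> [Q [bQ mQ PE PN]]; exists (fun n => act a @^-1` Q n); split.
- by move=> n; exact: borel_act.
- by move=> i j ij x; exact: mQ.
- by rewrite PE preimage_bigcup.
- move=> n; have [N [oN N1 NP]] := PN n.
  exists [set k | N (a * k * a^-1)%g]; split.
  + exact: (open_mulgl a (open_mulgr (a^-1)%g oN)).
  + by rewrite /= mulg1 mulgV.
  + move=> k x Nk Qx; rewrite /preimage /= -actM.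
    have -> : (a * k = a * k * a^-1 * a)%g by rewrite mulgVK.
    by rewrite actM; exact: NP.
Qed.

Section invariance.
Variables (x0 : X) (e : nat -> G) (mu : probability (borelType x0) R).
Hypothesis dense_e : dense (range e).
Hypothesis mu_e : forall n A, borel A -> mu (act (e n) @^-1` A) = mu A.

(** Some [h] in the dense range is so close to [g] that points brought into [Q n] by [h] are brought
    into [P] by [g]. Invariance under [h] bounds the measure of [Q n], and [n] tends to infinity. *)
Lemma tame_le P g : tame P -> (mu P <= mu (act g @^-1` P))%E.
Proof.
move=> tP; have [Q [bQ mQ PE PN]] := tP; have bP := tame_borel tP.
have bgP := borel_act g bP.
have cvgQ : (mu \o Q) n @[n --> \oo] --> mu P.
  rewrite PE; apply: nondecreasing_cvg_mu => //.
    exact: borel_bigcup.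
  by move=> i j ij; apply/subsetPset; exact: mQ.
rewrite -(cvg_lim _ cvgQ)//; apply: lime_le; first by apply/cvg_ex; exists (mu P).
apply: nearW => n /=; have [N [oN N1 NP]] := PN n.
have [|h [Nh [i _ ih]]] := @dense_e [set h | N (g * h^-1)%g] _
    (open_invg (open_mulgl g oN)).
  by exists g; rewrite /= mulgV.
rewrite -(mu_e i (bQ n)) ih; apply: le_measure; rewrite ?inE.
- exact: borel_act.
- exact: bgP.
- move=> x Qx; rewrite /preimage /=.
  have -> : g = (g * h^-1 * h)%g by rewrite mulgVK.
  by rewrite actM; exact: NP.
Qed.

Lemma tame_invariant P g : tame P -> mu (act g @^-1` P) = mu P.
Proof.
move=> tP; apply/eqP; rewrite eq_le tame_le// andbT.
have := tame_le (g^-1)%g (tame_translate g tP).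
rewrite (_ : _ @^-1` (_ @^-1` _) = P)//.
by apply/seteqP; split => x; rewrite /preimage /= actVr.
Qed.

Lemma gen_tame_invariant P g : <<s tame >> P -> mu (act g @^-1` P) = mu P.
Proof.
pose f : borelType x0 -> borelType x0 := act g.
have mf : measurable_fun setT f.
  by move=> _ Y mY; rewrite setTI; exact: borel_act.
pose nu := measure_function_pushforward__canonical__measure_function_Measure mu mf.
move=> sP; apply: (@g_sigma_algebra_measure_unique _ R (borelType x0) tame _
  (fun=> setT) _ _ nu mu) => //.
- exact: tame_borel.
- move=> _; exists (fun=> setT); split => //.
  + by move=> _; apply: borel_open; exact: openT.
  + by rewrite bigcup_const//; exists 0%N.
  + by move=> _; exists setT; split => //; exact: openT.
- by rewrite bigcup_const//; exists 0%N.
- exact: tameI.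
- by move=> A tA; exact: tame_invariant.
- by move=> _; rewrite /= /pushforward preimage_setT probability_setT ltry.
Qed.

(** The set [Q] may be arbitrary: the result is a finite union of atoms of the algebra generated by
    the first [n] sets. *)
Lemma agree_gen (c : nat -> set X) (Q : set X) n : (forall i, <<s tame >> (c i)) ->
  <<s tame >> [set z | exists2 y, Q y & forall i, (i < n)%N -> c i y <-> c i z].
Proof.
move=> tc; have sT : @sigma_algebra X setT <<s tame >> by exact: smallest_sigma_algebra.
have [s0 sC sU] := sT.
have sD A : <<s tame >> A -> <<s tame >> (~` A) by rewrite -setTD; exact: sC.
have sI A B : <<s tame >> A -> <<s tame >> B -> <<s tame >> (A `&` B).
  move=> tA tB; rewrite -[_ `&` _]setCK setCI -bigcup2E; apply: (sD).
  by apply: sU => -[|[|i]] //=; exact: sD.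
have sU2 A B : <<s tame >> A -> <<s tame >> B -> <<s tame >> (A `|` B).
  by move=> tA tB; rewrite -bigcup2E; apply: sU => -[|[|i]].
elim: n Q => [|n IH] Q.
  have [[y Qy]|Q0] := pselect (Q !=set0).
    rewrite (_ : mkset _ = setT); first by have := sD _ s0; rewrite setC0.
    by apply/seteqP; split => // z _; exists y.
  rewrite (_ : mkset _ = set0)//; apply/seteqP; split => // z [y Qy _].
  by apply: Q0; exists y.
rewrite (_ : mkset _ =
    (c n `&` [set z | exists2 y, (Q `&` c n) y &
       forall i, (i < n)%N -> c i y <-> c i z]) `|`
    (~` c n `&` [set z | exists2 y, (Q `&` ~` c n) y &
       forall i, (i < n)%N -> c i y <-> c i z])).
  by apply: sU2; apply: sI => //; exact: sD.
apply/seteqP; split => z.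
  move=> [y Qy yz]; have [cz|ncz] := pselect (c n z); [left|right].
    split => //; exists y => [|i lin]; last by apply: yz; exact: ltnW.
    by split => //; apply/yz.
  split => //; exists y => [|i lin]; last by apply: yz; exact: ltnW.
  by split => // /yz -/(_ (ltnSn n)).
move=> [|] [cz [y [Qy cy] yz]]; exists y => // i; rewrite ltnS leq_eqVlt.
  by move=> /predU1P[->|/yz//].
by move=> /predU1P[->|/yz//]; split.
Qed.

(* Standardness makes the countably many Vaught sets, which separate points,
   generate the Borel sets up to small measure. *)
Lemma gen_tame_approx (B : set X) (eps : R) : borel B -> (0 < eps)%R ->
  exists L, [/\ <<s tame >> L, L `<=` B & (mu B <= mu L + eps%:E)%E].
Proof.
move=> bB eps0.
have [BG [cBG oBG basisG]] := polish_basis polG.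
have [BX [cBX oBX basisX]] := polish_basis polX.
pose C : set (set X) := [set vact A U | A in BX & U in BG].
have cC : countable C.
  rewrite (_ : C = \bigcup_(A in BX) (vact A @` BG)).
    by apply: bigcup_countable => // A _; exact: sub_countable (card_image_le _ _) cBG.
  apply/seteqP; split => _ [A BA [U BU <-]]; first by exists A => //; exists U.
  by exists A => //; exists U.
have tC D : C D -> tame D.
  by move=> [A /oBX oA [U /oBG oU <-]]; apply: tame_vact => //; exact: borel_open.
have [c Cc] : exists c : nat -> set X, C = range c.
  have [U [BU _ _]] := basisG setT 1%g openT I.
  have [A [BA _ _]] := basisX setT x0 openT I.
  by apply: countable_enum => //; exists (vact A U); exists A => //; exists U.
have Cci i : C (c i) by rewrite Cc; exists i.
have c_sep x y : (forall i, c i x <-> c i y) -> x = y.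
  move=> xy; apply: (vact_separates cBX oBG oBX basisG basisX) => A U BA BU.
  have : C (vact A U) by exists A => //; exists U.
  by rewrite Cc => -[i _ <-].
have mBC : [set B] `|` C `<=` (measurable : set (set (borelType x0))).
  by move=> D [->//|/tC /tame_borel].
have [W [cW mW WBC]] :=
  polish_standard (x0 := x0) polX (countable_setU (countable1 B) cC) mBC.
have [f f_inj] := countable_injP _ cW.
(* [D n] is a tail of the union of sequence number [n]. Outside [N], the union of all [D n], each of
   the unions from [W] reduces to a finite one. *)
have /choice[D DP] : forall n, exists D, [/\ borel D,
    (mu D <= (eps / (2 ^ n.+1)%:R)%:E)%E &
    forall u, W u -> f u = n -> exists r,
      (\bigcup_i u i) `\` (\big[setU/set0]_(i < r) u i) `<=` D].
  move=> n; have e0 : (0 < eps / (2 ^ n.+1)%:R)%R by rewrite divr_gt0// ltr0n expn_gt0.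
  have [[u [Wu fu]]|nu] := pselect (exists u, W u /\ f u = n); last first.
    exists set0; split; [exact: borel0|by rewrite measure0 lee_fin ltW|].
    by move=> u Wu fu; case: nu; exists u.
  have bu i : borel (u i) by exact: mW.
  have bU : borel (\bigcup_i u i) by exact: borel_bigcup.
  pose v r := \big[setU/set0]_(i < r) u i.
  have bv r : borel (v r) by exact: borel_bigsetU.
  have [r mr] : exists r, (mu (\bigcup_i u i `\` v r) <= (eps / (2 ^ n.+1)%:R)%:E)%E.
    have bF r : borel (\bigcup_i u i `\` v r) by exact: borelD.
    have F0 : \bigcap_r (\bigcup_i u i `\` v r) = set0.
      apply/seteqP; split => // x Fx; have [[i _ ui] _] := Fx 0%N I.
      have [_] := Fx i.+1 I; apply; rewrite /v -bigcup_mkord.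
      by exists i => /=.
    have /= cvgF := @nonincreasing_cvg_mu _ (borelType x0) R mu _ _ bF _ _.
    have {}cvgF : mu (\bigcup_i u i `\` v r) @[r --> \oo] --> 0%E.
      rewrite -(measure0 mu) -F0; apply: cvgF.
      - apply: le_lt_trans (probability_le1 mu (bF 0%N)) _; exact: ltry.
      - by rewrite F0; exact: borel0.
      - move=> i j ij; apply/subsetPset => x [Ux nx]; split => // vx; apply: nx.
        move: vx; rewrite /v -!bigcup_mkord => -[k /= ki ?]; exists k => //=.
        exact: leq_trans ij.
    have /cvgF[K _ KP] : nbhs 0%E [set y | (y < (eps / (2 ^ n.+1)%:R)%:E)%E].
      apply: open_nbhs_nbhs; split; first exact: open_ereal_lt_ereal.
      by rewrite /= lte_fin.
    by exists K; apply: ltW; apply: KP => /=.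
  exists (\bigcup_i u i `\` v r); split => //.
    exact: borelD.
  by move=> w Ww fw; exists r; rewrite (f_inj w u) ?inE// fw.
pose N := \bigcup_n D n.
have bN : borel N by apply: borel_bigcup => n; case: (DP n).
have muN : (mu N <= eps%:E)%E.
  apply: (@le_trans _ _ (\sum_(n <oo) mu (D n))%E).
    by apply: measure_sigma_subadditive => // n; case: (DP n).
  apply: le_trans _ (epsilon_trick0 xpredT (ltW eps0)).
  by apply: lee_nneseries => // n _; case: (DP n).
pose S n := [set z | exists2 y, (B `\` N) y & forall i, (i < n)%N -> c i y <-> c i z].
exists (\bigcap_n S n).
have SB : \bigcap_n S n `<=` B.
  move=> z Sz.
  (* The ultrafilter lives on points of [B] outside [N] that agree with [z] on more and more tests.
     It resolves [W], hence is given by a point of [B] agreeing with [z] on all tests, and this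
     point is [z]. *)
  pose Z n : set X := [set y | ~ ((B `\` N) y /\ forall i, (i < n)%N -> c i y <-> c i z)].
  have [F FU FZ] : exists2 F : set (set X), UltraFilter F & forall n, F (~` Z n).
    apply: ultra_of_uncovered.
      move=> i j ij y nZ [By yz]; apply: nZ; split => // k ki; apply: yz.
      exact: leq_trans ij.
    move=> n ZT; have [y By yz] := Sz n I.
    by have nZ : Z n y; [rewrite ZT|exact: (nZ (conj By yz))].
  have Z_agree n y : (~` Z n) y -> (B `\` N) y /\
      forall i, (i < n)%N -> c i y <-> c i z by move=> /contrapT.
  have [u Wu FUu|x xP] := WBC F FU.
    have [_ _ /(_ u Wu erefl)[r sub]] := DP (f u).
    apply: (@ultra_bigU _ _ _ r) => //.
    apply: filterS (filterI FUu (FZ 0%N)) => y [uy /Z_agree[[_ nN] _]].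
    apply: contrapT => nr; apply: nN; exists (f u) => //; exact: sub.
  have Bx : B x.
    apply/(xP B (or_introl erefl)); apply: filterS (FZ 0%N) => y /Z_agree[[By _] _].
    exact: By.
  suff -> : z = x by [].
  apply: c_sep => i; have ci := xP (c i) (or_intror (Cci i)); split.
    move=> cz; apply/ci; apply: filterS (FZ i.+1) => y /Z_agree[_ yz].
    by apply/yz.
  move=> /ci Fc; have [y [cy /Z_agree[_ yz]]] := filter_ex (filterI Fc (FZ i.+1)).
  by apply/yz.
have sS : <<s tame >> (\bigcap_n S n).
  rewrite -[X in <<s _ >> X]setCK setC_bigcap.
  have [s0 sC sU] := @smallest_sigma_algebra X setT tame.
  rewrite -setTD; apply: (sC); apply: sU => n; rewrite -setTD; apply: (sC).
  by apply: agree_gen => i; apply: sub_sigma_algebra; exact: tC.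
split => //.
have bBN : borel (B `\` N) by exact: borelD.
have bS : borel (\bigcap_n S n) by exact: gen_tame_borel.
apply: le_trans (leeD (le_refl _) muN).
apply: le_trans (measureU2 _ _ _) => //.
apply: le_measure; rewrite ?inE//; first exact: borelU.
move=> x Bx; have [?|nN] := pselect (N x); [by right|left].
by move=> n _; exists x.
Qed.

Lemma borel_invariant A g : borel A -> mu (act g @^-1` A) = mu A.
Proof.
have mle B k : borel B -> (mu B <= mu (act k @^-1` B))%E.
  move=> bB; apply/lee_addgt0Pr => eps eps0.
  have [L [tL LB le]] := gen_tame_approx bB eps0.
  apply: le_trans le _; rewrite leeD2r// -(gen_tame_invariant k tL).
  have bL := gen_tame_borel tL.
  apply: le_measure; rewrite ?inE; [exact: borel_act|exact: borel_act|].
  by move=> x /LB.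
move=> bA; apply/eqP; rewrite eq_le mle// andbT.
have := mle _ (g^-1)%g (borel_act g bA).
rewrite (_ : _ @^-1` (_ @^-1` _) = A)//.
by apply/seteqP; split => x; rewrite /preimage /= actVr.
Qed.

End invariance.
End action.

(** * The two implications *)

Section main.
Context (R : realType) (G : topologicalGroupType) (X : topologicalType)
  (act : G -> X -> X).
Hypothesis polG : polish R G.
Hypothesis polX : polish R X.
Hypothesis actB : borel_action act.

Let act1 x : act 1%g x = x. Proof. by case: actB => -[]. Qed.
Let actM g k x : act (g * k)%g x = act g (act k x).
Proof. by case: actB => -[]. Qed.
Let actV g x : act (g^-1)%g (act g x) = x.
Proof. by rewrite -actM mulVg act1. Qed.
Let actVr g x : act g (act (g^-1)%g x) = x.
Proof. by rewrite -actM mulgV act1. Qed.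

Lemma borel_act_image g A : borel A -> borel (act g @` A).
Proof. by move=> bA; rewrite act_image//; exact: borel_act. Qed.

Lemma dense_subgroup_action (x0 : X) : exists (e : nat -> G)
  (h : countable_action (borelType x0)),
  dense (range e) /\ forall n x, h n x = act (e n) x.
Proof.
have [[S cS dS] _] := polG.
pose op (n : nat) (g k : G) := if n is 0 then (g * k)%g else (g^-1)%g.
have [C [cC SC Cop]] :=
  countable_closure op (countable_setU (countable1 1%g) cS).
have C1 : C 1%g by apply: SC; left.
have [e Ce] : exists e : nat -> G, C = range e.
  by apply: countable_enum => //; exists 1%g.
have Cei n : C (e n) by rewrite Ce; exists n.
have inC g : C g -> exists n, e n = g by rewrite Ce => -[n _ <-]; exists n.
have [one e1] := inC _ C1.
have /choice[inv eV] : forall a, exists n, e n = ((e a)^-1)%g.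
  by move=> a; apply: inC; exact: (Cop 1%N _ (e a)).
have /choice[mul eM] : forall ab : nat * nat, exists n, e n = (e ab.1 * e ab.2)%g.
  by move=> ab; apply: inC; exact: (Cop 0%N).
unshelve refine (ex_intro _ e (ex_intro _ (@CountableAction _ (borelType x0)
  (fun n => act (e n)) one inv (fun a b => mul (a, b)) _ _ _ _ _) _)) => /=.
- by move=> x; rewrite e1 act1.
- by move=> a b x; rewrite eM actM.
- by move=> a x; rewrite eV actV.
- by move=> a x; rewrite eV actVr.
- by move=> a A; exact: borel_act.
- split => // U oU U0; have [x [Ux Sx]] := dS U oU U0.
  by exists x; split => //; rewrite -Ce; apply: SC; right.
Qed.

(** The images of copies 0 and 1 of the space are the two disjoint sets. Their target has a single
    level, so distinct source points have distinct images already in [X]. *)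
Lemma paradoxical_of_null (x0 : X) (e : nat -> G)
    (h : countable_action (borelType x0)) :
  (forall n x, h n x = act (e n) x) -> null h setT -> countably_paradoxical act.
Proof.
move=> he [_ _ [t [mt tTP t_inj]]].
pose g i x := (t (x, i)).1.
pose F i n : set X := [set x | g i x = n].
have inj i j x y : act (e (g i x)) x = act (e (g j y)) y -> (x, i) = (y, j).
  move=> exy; apply: t_inj => //.
  have [_ +] := tTP (x, i) I; have [_ +] := tTP (y, j) I.
  rewrite /send /= !he -/(g i x) -/(g j y) exy !add0n !ltnS !leqn0.
  by move=> /eqP-> /eqP->.
have bF i n : borel (F i n).
  have -> : F i n = \bigcup_m [set x | copies setT (x, i) /\ t (x, i) = (n, m)].
    apply/seteqP; split => x; last by move=> [m _ [_]]; rewrite /F /g /= => ->.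
    by move=> <-; exists (t (x, i)).2 => //; split => //; rewrite /g; case: (t _).
  by apply: borel_bigcup => m; exact: mt.
have bFF n m : borel (F 0%N n `&` F 1%N m) by exact: borelI.
pose E i n := act (e n) @` F i n.
exists (\bigcup_n E 0%N n), (\bigcup_n E 1%N n); split.
- by apply: borel_bigcup => n; exact: borel_act_image.
- by apply: borel_bigcup => n; exact: borel_act_image.
- apply/seteqP; split => // y [[n _ [x Fx <-]] [m _ [z Fz]]].
  by rewrite -[m]Fz -[n in RHS]Fx => /inj [].
- exists nat, (F 0%N), (E 0%N), e; split => //; split => //.
  + by move=> n m _ _ [x [/= <- <-]].
  + by apply/seteqP; split => // x _; exists (g 0%N x).
  + by move=> n; exact: borel_act_image.
  + move=> n m _ _ [y [[x Fx <-] [z Fz]]].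
    by rewrite -[m]Fz -[n in RHS]Fx => /inj [->].
(* Both sets are cut according to the pair of moves used at levels 0 and 1; going back along the
   first and forward along the second matches the pieces. *)
- exists (nat * nat)%type, (fun nm => act (e nm.1) @` (F 0%N nm.1 `&` F 1%N nm.2)),
    (fun nm => act (e nm.2) @` (F 0%N nm.1 `&` F 1%N nm.2)),
    (fun nm => e nm.2 * (e nm.1)^-1)%g; split.
  + split.
    * by move=> nm; exact: borel_act_image.
    * move=> [n m] [n' m'] _ _ [y [[x /= [F0 F1] <-] [z [F0' F1']]]].
      rewrite -[n in RHS]F0 -[n' in LHS]F0' => /inj[zx].
      by rewrite -F0 -F1 -F0' -F1' zx.
    * apply/seteqP; split => y; last by move=> [[n m] _ [x [? _] <-]]; exists n => //; exists x.
      by move=> [n _ [x Fx <-]]; exists (n, g 1%N x) => //; exists x.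
  + split.
    * by move=> nm; exact: borel_act_image.
    * move=> [n m] [n' m'] _ _ [y [[x /= [F0 F1] <-] [z [F0' F1']]]].
      rewrite -[m in RHS]F1 -[m' in LHS]F1' => /inj[zx].
      by rewrite -F0 -F1 -F0' -F1' zx.
    * apply/seteqP; split => y; last by move=> [[n m] _ [x [_ ?] <-]]; exists m => //; exists x.
      by move=> [m _ [x Fx <-]]; exists (g 0%N x, m) => //; exists x.
  + move=> [n m] /=; apply/seteqP; split => y.
      by move=> [_ [x Fx <-] <-]; exists x => //; rewrite actM actV.
    by move=> [x Fx <-]; exists (act (e n) x); [exists x|rewrite actM actV].
Qed.

Section measure.
Variables (x0 : X) (mu : probability (borelType x0) R).
Hypothesis mu_inv : invariant_measure act mu.

Lemma measure_countable_partition (I : countType) (A : set X) (F : I -> set X) :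
  borel_partition A F -> (mu A = \sum_(n <oo)
    if pickle_inv n is Some i then mu (F i) else 0)%E.
Proof.
move=> [bF tF ->].
pose F' n := if pickle_inv n is Some i then F i else set0.
have bF' n : borel (F' n).
  by rewrite /F'; case: pickle_inv => [i|]; [exact: bF|exact: borel0].
have -> : \bigcup_i F i = \bigcup_n F' n.
  apply/seteqP; split => x [i _].
    by move=> Fx; exists (pickle i) => //; rewrite /F' pickleK_inv.
  by rewrite /F'; case: pickle_inv => // j Fx; exists j.
have tF' : trivIset setT F'.
  move=> n m _ _ [x []]; rewrite /F'.
  case en : (pickle_inv n) => [i|//]; case em : (pickle_inv m) => [j|//] Fi Fj.
  have ij : i = j by apply: tF => //; exists x.
  have := pickle_invK (T := I) n; rewrite en /= => <-.
  by have := pickle_invK (T := I) m; rewrite em /= => <-; rewrite ij.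
rewrite measure_bigcup//; last by move=> n _; exact: bF'.
rewrite (eq_eseriesl (Q := xpredT)) => [|n]; last by rewrite in_setT.
by apply: eq_eseriesr => n _; rewrite /F'; case: pickle_inv => //; rewrite measure0.
Qed.

Lemma measure_equidecomposable A B : countable_equidecomposable act A B -> mu A = mu B.
Proof.
move=> [I [F [E [g [pF pE FE]]]]].
rewrite (measure_countable_partition pF) (measure_countable_partition pE).
apply: eq_eseriesr => n _; case: pickle_inv => // i.
by rewrite -FE; apply: mu_inv; case: pF.
Qed.

Lemma not_paradoxical_of_measure : ~ countably_paradoxical act.
Proof.
move=> [A [B [bA bB AB TA AB']]].
have muA : mu A = 1%E by rewrite -(measure_equidecomposable TA) probability_setT.
have muB : mu B = 1%E by rewrite -(measure_equidecomposable AB').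
have muU : mu (A `|` B) = (mu A + mu B)%E by exact: measureU.
have : (mu (A `|` B) <= 1)%E by apply: probability_le1; exact: borelU.
by rewrite muU muA muB -EFinD lee_fin; lra.
Qed.

End measure.

(** Guarantees that a space that is not paradoxical has a base point. *)
Lemma empty_paradoxical : (forall x : X, False) -> countably_paradoxical act.
Proof.
move=> noX; have setE (A B : set X) : A = B by apply/seteqP; split => x; case: (noX x).
have eqd A B : countable_equidecomposable act A B.
  exists nat, (fun=> set0), (fun=> set0), (fun=> 1%g); split; last by move=> i; exact: setE.
    by split => [_|i j _ _ [x]|]; [exact: borel0|case: (noX x)|exact: setE].
  by split => [_|i j _ _ [x]|]; [exact: borel0|case: (noX x)|exact: setE].
by exists set0, set0; split; [exact: borel0|exact: borel0|exact: setE| |].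
Qed.

Lemma measure_of_not_paradoxical : ~ countably_paradoxical act ->
  exists (x0 : X) (mu : probability (borelType x0) R), invariant_measure act mu.
Proof.
move=> npar.
have [x0 _] : exists x0 : X, True.
  by apply: contrapT => nx; apply: npar; apply: empty_paradoxical => x; apply: nx; exists x.
have [e [h [de he]]] := dense_subgroup_action x0.
have [B [cB oB basisB]] := polish_basis polX.
have nn : ~ null h setT by move=> /(paradoxical_of_null he).
have BM : B `<=` (measurable : set (set (borelType x0))).
  by move=> A /oB; exact: borel_open.
have MB : (measurable : set (set (borelType x0))) `<=` <<s B >>.
  apply: smallest_sub; first exact: smallest_sigma_algebra.
  move=> U oU.
  have cBU : countable (B `&` [set V | V `<=` U]).
    by apply: sub_countable cB; apply: subset_card_le => V [].
  have [u [uE uP]] := bigcup_countable_nat id cBU.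
  have -> : U = \bigcup_n u n.
    rewrite -uE; apply/seteqP; split => x; last by move=> [V [_ VU]]; exact: VU.
    by move=> Ux; have [V [BV Vx VU]] := basisB _ _ oU Ux; exists V.
  apply: sigma_algebra_bigcup => n; case: (uP n) => [->|[V [BV _] ->]].
    exact: sigma_algebra0.
  exact: sub_sigma_algebra.
have [mu mu_h] := nadkarni R nn (polish_standard polX) cB BM MB.
exists x0, mu => g A bA; rewrite act_image//; apply/esym.
apply: (borel_invariant polG polX actB de) => // n C bC.
have -> : act (e n) @^-1` C = h n @^-1` C.
  by apply/seteqP; split => x; rewrite /preimage /= he.
exact: mu_h.
Qed.

End main.

Theorem theorem3p2 (R : realType) (G : topologicalGroupType)
    (X : topologicalType) (act : G -> X -> X)
    (polishG : polish R G) (polishX : polish R X)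
    (actB : borel_action act) :
  ~ countably_paradoxical act <->
  exists (x0 : X) (mu : probability (borelType x0) R),
    invariant_measure act mu.
Proof.
split; first exact: measure_of_not_paradoxical.
by move=> [x0 [mu mu_inv]]; exact: (not_paradoxical_of_measure mu_inv).
Qed.
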